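(* Let $f\in\mathcal{S}^*_S$, and let $T_{2,1}(F_{f^{-1}}/2)=\Gamma_1^2-\Gamma_2^2$, where $\Gamma_1,\Gamma_2$ are the first two logarithmic coefficients of the inverse function $f^{-1}$. Then $$|T_{2,1}(F_{f^{-1}}/2)|\leq \frac5{16} .$$ The inequality is sharp, with extremal function $h_5(z)=\dfrac{z}{1-iz}=z+iz^2-z^3-iz^4+z^5+\cdots$, $z\in\mathbb{D}$; that is, $h_5\in\mathcal{S}^*_S$ and $|T_{2,1}(F_{h_5^{-1}}/2)|=\frac5{16}$.
   Context: Let $\mathbb{D}=\{z\in\mathbb{C}:|z|<1\}$, and let $\mathcal{A}$ be the class of holomorphic functions $f$ on $\mathbb{D}$ with $f(0)=0$ and $f'(0)=1$, so that $f(z)=z+\sum_{n=2}^\infty a_nz^n$. The class $\mathcal{S}^*_S$ of functions starlike with respect to symmetric points consists of all $f\in\mathcal{A}$ such that $$\mathrm{Re}\left(\frac{zf'(z)}{f(z)-f(-z)}\right)>0,\qquad z\in\mathbb{D},$$ where the quotient at $z=0$ is understood as its limit $1/2$. Such functions are univalent. For such $f$, let $F=f^{-1}$ be its inverse function, defined and holomorphic in a neighborhood of the origin (one may take $|w|<1/4$), with $F(w)=w+\sum_{n\ge2}A_nw^n$. The logarithmic coefficients $\Gamma_n=\Gamma_n(F)$ of the inverse function are defined by $$\log\left(\frac{F(w)}{w}\right)=2\sum_{n=1}^\infty \Gamma_n w^n\quad\text{near } w=0,\qquad \log 1:=0.$$ The second Toeplitz determinant of these coefficients is $$T_{2,1}(F_{f^{-1}}/2)=\begin{vmatrix}\Gamma_1&\Gamma_2\\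 \Gamma_2&\Gamma_1\end{vmatrix}=\Gamma_1^2-\Gamma_2^2 .$$ *)

(* Defs.v *)
From Stdlib Require Import Reals.
From Coquelicot Require Import Coquelicot.
Open Scope R_scope.

Definition disc (r : R) (z : C) : Prop := Cmod z < r.

(* Meant for open [D]: complex differentiability at every point of [D].
   Values of [f] outside [D] are irrelevant. *)
Definition holomorphic_on (D : C -> Prop) (f : C -> C) : Prop :=
  forall z : C, D z -> @ex_derive C_AbsRing C_NormedModule f z.

Definition class_A (f : C -> C) : Prop :=
  holomorphic_on (disc 1) f /\ f (RtoC 0) = RtoC 0 /\
  C_derive f (RtoC 0) = RtoC 1.

(* At z = 0 the quotient stands for its limit 1/2, whose real part is
   positive, so only z <> 0 carries a condition.  For z <> 0 the quotient has
   to be defined, hence the explicit f z <> f (-z). *)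
Definition starlike_symmetric (f : C -> C) : Prop :=
  class_A f /\
  forall z : C, disc 1 z -> z <> RtoC 0 ->
    f z <> f (Copp z) /\
    0 < Re (z * C_derive f z / (f z - f (- z)))%C.

(* [F] is the germ at 0 of the inverse function of [f] on the unit disc. *)
Definition local_inverse (f F : C -> C) : Prop :=
  (exists r : R, 0 < r /\ holomorphic_on (disc r) F /\
     forall w : C, disc r w -> disc 1 (F w) /\ f (F w) = w) /\
  (exists r : R, 0 < r /\ forall z : C, disc r z -> F (f z) = z).

Definition Cexp (z : C) : C :=
  (exp (Re z) * cos (Im z), exp (Re z) * sin (Im z)).

(* [L] is, on the disc of radius r, the continuous branch of log (F w / w)
   with value 0 at w = 0, where F w / w is extended by its limit 1. *)
Definition log_branch (F L : C -> C) (r : R) : Prop :=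
  L (RtoC 0) = RtoC 0 /\
  forall w : C, disc r w ->
    @continuous C_UniformSpace C_UniformSpace L w /\
    (w <> RtoC 0 -> Cexp (L w) = (F w / w)%C).

(* log (F w / w) = 2 (Gamma_1 w + Gamma_2 w^2 + ...) near 0.  The sum starts
   at index 1, so [Gamma 0] plays no role. *)
Definition log_coefficients (F : C -> C) (Gamma : nat -> C) : Prop :=
  exists (r : R) (L : C -> C), 0 < r /\ log_branch F L r /\
    forall w : C, disc r w ->
      exists s : C,
        @is_series C_AbsRing C_NormedModule
          (fun n : nat => Gamma (S n) * w ^ (S n))%C s /\
        L w = (RtoC 2 * s)%C.

Definition inverse_log_coefficients (f : C -> C) (Gamma : nat -> C) : Prop :=
  exists F : C -> C, local_inverse f F /\ log_coefficients F Gamma.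

(* The determinant of the rows (Gamma_1, Gamma_2) and (Gamma_2, Gamma_1). *)
Definition T21 (Gamma : nat -> C) : C :=
  (Gamma 1%nat ^ 2 - Gamma 2%nat ^ 2)%C.

Definition h5 (z : C) : C := (z / (RtoC 1 - Ci * z))%C.

(* Main.v *)
Require Import Defs.
From Stdlib Require Import Reals Lra Lia ClassicalEpsilon.
From Coquelicot Require Import Coquelicot.
Open Scope R_scope.

(** Write f(z) = z + a2 z^2 + a3 z^3 + ... and p(z) = 2 z f'(z) / (f(z) - f(-z)).
    The hypothesis on f says that p has positive real part, and comparing
    coefficients gives p(z) = 1 + c1 z + c2 z^2 + ... with c1 = 2 a2 and
    c2 = 2 a3.  Substituting F(w) = w exp (2 Gamma_1 w + 2 Gamma_2 w^2 + ...)
    into f(F(w)) = w gives Gamma_1 = - a2 / 2 and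
    Gamma_2 = - (a3 - 3/2 a2^2) / 2, so that

      16 |Gamma_1^2 - Gamma_2^2| <= |c1|^2 + |c2 - 3/4 c1^2|^2.

    Caratheodory's inequality |c2 - c1^2/2| <= 2 - |c1|^2/2 for functions of
    positive real part ([caratheodory_second_coefficient]) bounds the last
    modulus by 2 - |c1|^2/4.  With t = |c1|^2, which lies in [0, 4], the right
    hand side is at most t + (2 - t/4)^2 = 4 + t^2/16 <= 5.

    Functions are only assumed complex differentiable at each point, so the
    proof needs a form of Cauchy's theorem.  It rests on [half_plane_principle]:
    if g is differentiable on a punctured disc containing the unit circle, has
    limit c at 0, and Re g >= 0 on the unit circle, then Re c >= 0.  In the
    coordinate s = log z this says that the integral of Re g(e^(x+iy)) over a
    period of y does not depend on x, which is Goursat's theorem on a rectangle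
    for a periodic closed form ([goursat_rectangle]).  The principle is used
    twice.
    - Applied to constant minus a rotated difference quotient, it gives
      Cauchy's estimate for f'(b), and from this estimate alone follows that f'
      is again complex differentiable ([C_derive_cdiff]).  Hence f has the
      Taylor expansions needed to compare coefficients.
    - Applied to p |q|^2 for a quadratic polynomial q, rewritten on the circle
      as the real part of a function regular at 0, it gives positivity of the
      Toeplitz form of p ([toeplitz_positivity]); a suitable q yields
      Caratheodory's inequality.

    For h5(z) = z / (1 - iz) the inverse is w / (1 + iw), so
    log (F(w) / w) = - log (1 + iw) and Gamma_n = (-i)^n / (2n).  Then
    Gamma_1^2 - Gamma_2^2 = - 1/4 - 1/16 = - 5/16, which gives equality. *)

(** * Goursat's theorem for closed real forms on rectangles *)

Lemma nested_intervals (h : R) (u : nat -> R) :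
  0 <= h ->
  (forall n, u (S n) = u n \/ u (S n) = u n + h / 2 ^ S n) ->
  exists x, forall n, u n <= x <= u n + h / 2 ^ n.
Proof.
  intros Hh Hu.
  assert (Hp : forall n, 0 < 2 ^ n) by (intro; apply pow_lt; lra).
  assert (Hq : forall n, 0 <= h / 2 ^ n).
  { intro n. apply Rmult_le_pos; [lra|]. left. apply Rinv_0_lt_compat, Hp. }
  assert (Hd : forall n, h / 2 ^ n = h / 2 ^ S n + h / 2 ^ S n).
  { intro n. simpl. specialize (Hp n). field. lra. }
  assert (Hm : forall n k, u n <= u (n + k)%nat /\
             u (n + k)%nat + h / 2 ^ (n + k) <= u n + h / 2 ^ n).
  { intros n k. induction k as [|k IH].
    - rewrite Nat.add_0_r. lra.
    - rewrite Nat.add_succ_r. specialize (Hd (n + k)%nat). specialize (Hq (S (n + k))).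
      specialize (Hu (n + k)%nat).
      destruct Hu as [E|E]; rewrite E; lra. }
  destruct (completeness (fun x => exists n, x = u n)) as [x [Hx1 Hx2]].
  - exists (u 0%nat + h / 2 ^ 0). intros y [n ->].
    destruct (Hm 0%nat n) as [_ H]. rewrite Nat.add_0_l in H. specialize (Hq n). lra.
  - exists (u 0%nat). now exists 0%nat.
  - exists x. intro n. split.
    + apply Hx1. now exists n.
    + apply Hx2. intros y [m ->].
      destruct (Nat.le_ge_cases n m) as [L|L].
      * replace m with (n + (m - n))%nat by lia.
        destruct (Hm n (m - n)%nat) as [_ H]. specialize (Hq (n + (m - n))%nat). lra.
      * destruct (Hm m (n - m)%nat) as [H _].
        replace (m + (n - m))%nat with n in H by lia. specialize (Hq n). lra.
Qed.

(** The compactness behind Goursat's argument: a property of rectangles that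
    always passes to one of the four quarters singles out a limit point.  The
    rectangles are similar copies, with ratio s, of one of sides h and k, so
    that the sides are comparable to the square root of the area. *)
Lemma rectangle_bisection (h k : R) (Bad : R -> R -> R -> Prop) (x0 y0 : R) :
  0 <= h -> 0 <= k ->
  (forall x y s, Bad x y s -> exists x' y',
     (x' = x \/ x' = x + h * (s / 2)) /\ (y' = y \/ y' = y + k * (s / 2)) /\
     Bad x' y' (s / 2)) ->
  Bad x0 y0 1 ->
  exists x y, forall n, exists x' y', Bad x' y' (/ 2 ^ n) /\
    x' <= x <= x' + h / 2 ^ n /\ y' <= y <= y' + k / 2 ^ n.
Proof.
  intros Hh Hk Hsplit H0.
  assert (Hp : forall n, 0 < 2 ^ n) by (intro; apply pow_lt; lra).
  assert (St : forall n (p : {q : R * R | Bad (fst q) (snd q) (/ 2 ^ n)}),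
    {q : {q : R * R | Bad (fst q) (snd q) (/ 2 ^ S n)} |
      (fst (proj1_sig q) = fst (proj1_sig p) \/
       fst (proj1_sig q) = fst (proj1_sig p) + h / 2 ^ S n) /\
      (snd (proj1_sig q) = snd (proj1_sig p) \/
       snd (proj1_sig q) = snd (proj1_sig p) + k / 2 ^ S n)}).
  { intros n [[x y] B]. apply constructive_indefinite_description. simpl in *.
    destruct (Hsplit _ _ _ B) as (x' & y' & Hx & Hy & B').
    specialize (Hp n).
    replace (/ 2 ^ n / 2) with (/ (2 * 2 ^ n)) in * by (field; lra).
    exists (exist _ (x', y') B'). simpl. split; assumption. }
  assert (B0 : Bad (fst (x0, y0)) (snd (x0, y0)) (/ 2 ^ 0)).
  { simpl. now rewrite Rinv_1. }
  pose (sq := fix sq (n : nat) : {q : R * R | Bad (fst q) (snd q) (/ 2 ^ n)} :=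
    match n with O => exist _ (x0, y0) B0 | S n => proj1_sig (St n (sq n)) end).
  destruct (nested_intervals h (fun n => fst (proj1_sig (sq n))) Hh) as [x Hx].
  { intro n. exact (proj1 (proj2_sig (St n (sq n)))). }
  destruct (nested_intervals k (fun n => snd (proj1_sig (sq n))) Hk) as [y Hy].
  { intro n. exact (proj2 (proj2_sig (St n (sq n)))). }
  exists x, y. intro n.
  exists (fst (proj1_sig (sq n))), (snd (proj1_sig (sq n))).
  split; [exact (proj2_sig (sq n))|]. split; [apply Hx | apply Hy].
Qed.

Lemma RInt_near_const (g : R -> R) (a b c M : R) :
  a <= b -> ex_RInt g a b ->
  (forall t, a <= t <= b -> Rabs (g t - c) <= M) ->
  Rabs (RInt g a b - c * (b - a)) <= M * (b - a).
Proof.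
  intros Hab Hg HM.
  replace (RInt g a b - c * (b - a)) with (RInt (fun t => g t - c) a b).
  - rewrite (Rmult_comm M). apply abs_RInt_le_const; auto.
    apply (ex_RInt_minus (V := R_NormedModule)); auto. apply ex_RInt_const.
  - rewrite (RInt_minus (V := R_CompleteNormedModule)); auto.
    + rewrite RInt_const. unfold minus, plus, opp, scal; simpl. unfold mult; simpl. ring.
    + apply ex_RInt_const.
Qed.

Lemma differentiable_pt_lim_continuous (P : R -> R -> R) (x y a b : R) :
  differentiable_pt_lim P x y a b ->
  continuous (fun t => P t y) x /\ continuous (fun t => P x t) y.
Proof.
  intro H.
  assert (C : continuity_2d_pt P x y).
  { apply differentiable_continuity_pt. now exists a, b. }
  split; apply continuity_pt_filterlim; intros e He;
    destruct (C (mkposreal e He)) as [d Hd]; exists d;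
    (split; [apply cond_pos|]); intros t [_ Ht]; apply Hd; trivial;
    rewrite Rminus_diag, Rabs_R0; apply cond_pos.
Qed.

(** The form P dx + Q dy on the half-plane x < X, with the cross derivatives
    dP/dy = dQ/dx = b.  The partial derivatives need not be continuous, so the
    integral along a closed path cannot be computed by differentiating under
    the integral. *)
Definition closed_form (P Q : R -> R -> R) (X : R) : Prop :=
  forall x y, x < X -> exists a b d,
    differentiable_pt_lim P x y a b /\ differentiable_pt_lim Q x y b d.

(** Counterclockwise integral of P dx + Q dy.  Opposite sides are grouped, so that
    each integrand is a difference to which the affine approximation applies. *)
Definition boundary_integral (P Q : R -> R -> R) (x y h k : R) : R :=
  RInt (fun t => P t y - P t (y + k)) x (x + h) +
  RInt (fun t => Q (x + h) t - Q x t) y (y + k).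

Lemma ex_RInt_horizontal (P Q : R -> R -> R) (X y a b : R) :
  closed_form P Q X -> a <= b -> b < X -> ex_RInt (fun t => P t y) a b.
Proof.
  intros Hcl Hab Hb. apply (ex_RInt_continuous (V := R_CompleteNormedModule)). intros t Ht.
  rewrite Rmin_left, Rmax_right in Ht by lra.
  destruct (Hcl t y) as (p & q & d & H & _); [lra|].
  exact (proj1 (differentiable_pt_lim_continuous _ _ _ _ _ H)).
Qed.

Lemma ex_RInt_vertical (P Q : R -> R -> R) (X x a b : R) :
  closed_form P Q X -> x < X -> ex_RInt (fun t => Q x t) a b.
Proof.
  intros Hcl Hx. apply (ex_RInt_continuous (V := R_CompleteNormedModule)). intros t _.
  destruct (Hcl x t) as (p & q & d & _ & H); [lra|].
  exact (proj2 (differentiable_pt_lim_continuous _ _ _ _ _ H)).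
Qed.

Lemma boundary_integral_expand (P Q : R -> R -> R) (X x y h k : R) :
  closed_form P Q X -> 0 <= h -> x + h < X ->
  boundary_integral P Q x y h k =
  RInt (fun t => P t y) x (x + h) - RInt (fun t => P t (y + k)) x (x + h) +
  (RInt (fun t => Q (x + h) t) y (y + k) - RInt (fun t => Q x t) y (y + k)).
Proof.
  intros Hcl Hh Hx. unfold boundary_integral.
  rewrite (RInt_minus (V := R_CompleteNormedModule));
    try (apply (ex_RInt_horizontal P Q X); trivial; lra).
  rewrite (RInt_minus (V := R_CompleteNormedModule));
    try (apply (ex_RInt_vertical P Q X); trivial; lra).
  reflexivity.
Qed.

Lemma boundary_integral_split (P Q : R -> R -> R) (X x y h k : R) :
  closed_form P Q X -> 0 <= h -> x + 2 * h < X ->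
  boundary_integral P Q x y (2 * h) (2 * k) =
  boundary_integral P Q x y h k + boundary_integral P Q (x + h) y h k +
  (boundary_integral P Q x (y + k) h k + boundary_integral P Q (x + h) (y + k) h k).
Proof.
  intros Hcl Hh Hx. rewrite !(boundary_integral_expand P Q X) by (trivial; lra).
  replace (x + h + h) with (x + 2 * h) by ring.
  replace (y + k + k) with (y + 2 * k) by ring.
  assert (CP : forall v, RInt (fun t => P t v) x (x + 2 * h) =
    RInt (fun t => P t v) x (x + h) + RInt (fun t => P t v) (x + h) (x + 2 * h)).
  { intro v. symmetry. apply (RInt_Chasles (V := R_CompleteNormedModule));
      apply (ex_RInt_horizontal P Q X); trivial; lra. }
  assert (CQ : forall v, v < X -> RInt (fun t => Q v t) y (y + 2 * k) =
    RInt (fun t => Q v t) y (y + k) + RInt (fun t => Q v t) (y + k) (y + 2 * k)).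
  { intros v Hv. symmetry. apply (RInt_Chasles (V := R_CompleteNormedModule));
      apply (ex_RInt_vertical P Q X); trivial; lra. }
  rewrite !CP, !CQ by lra. ring.
Qed.

(** An affine closed form has integral 0 along a rectangle: the two pairs of
    opposite sides contribute - b h k and b h k.  What remains near (x, y) is the
    error of the affine approximation, of size e (h + k) at each point of a
    path of length 2 (h + k). *)
Lemma boundary_integral_small (P Q : R -> R -> R) (X x y e : R) :
  closed_form P Q X -> x < X -> 0 < e ->
  exists delta, 0 < delta /\ forall u v h k,
    0 <= h -> 0 <= k -> u <= x <= u + h -> v <= y <= v + k -> u + h < X ->
    h + k < delta ->
    Rabs (boundary_integral P Q u v h k) <= e * (h + k) ^ 2.
Proof.
  intros Hcl Hx He. destruct (Hcl x y Hx) as (a & b & d & HP & HQ).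
  assert (He2 : 0 < e / 2) by lra.
  destruct (HP (mkposreal _ He2)) as [d1 H1]. destruct (HQ (mkposreal _ He2)) as [d2 H2].
  exists (Rmin d1 d2). split; [apply Rmin_pos; apply cond_pos|].
  intros u v h k Hh Hk Hu Hv HX Hd.
  assert (Hd1 : h + k < d1) by (eapply Rlt_le_trans; [exact Hd|apply Rmin_l]).
  assert (Hd2 : h + k < d2) by (eapply Rlt_le_trans; [exact Hd|apply Rmin_r]).
  simpl in H1, H2.
  assert (AB : forall s t, u <= s <= u + h -> v <= t <= v + k ->
     Rabs (s - x) <= h + k /\ Rabs (t - y) <= h + k).
  { intros s t Hs Ht. split; apply Rabs_le; lra. }
  assert (K1 : forall s t, u <= s <= u + h -> v <= t <= v + k ->
     Rabs (P s t - P x y - (a * (s - x) + b * (t - y))) <= e / 2 * (h + k)).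
  { intros s t Hs Ht. destruct (AB s t Hs Ht) as [A1 A2].
    eapply Rle_trans; [apply H1; lra|]. apply Rmult_le_compat_l; [lra|].
    now apply Rmax_lub. }
  assert (K2 : forall s t, u <= s <= u + h -> v <= t <= v + k ->
     Rabs (Q s t - Q x y - (b * (s - x) + d * (t - y))) <= e / 2 * (h + k)).
  { intros s t Hs Ht. destruct (AB s t Hs Ht) as [A1 A2].
    eapply Rle_trans; [apply H2; lra|]. apply Rmult_le_compat_l; [lra|].
    now apply Rmax_lub. }
  assert (I1 : Rabs (RInt (fun t => P t v - P t (v + k)) u (u + h) - (- b * k) * (u + h - u))
               <= e * (h + k) * (u + h - u)).
  { apply RInt_near_const; [lra| |].
    - apply (ex_RInt_minus (V := R_NormedModule)); apply (ex_RInt_horizontal P Q X); trivial; lra.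
    - intros t Ht. pose proof (K1 t v Ht ltac:(lra)) as E1.
      pose proof (K1 t (v + k) Ht ltac:(lra)) as E2.
      apply Rabs_le_between in E1. apply Rabs_le_between in E2. apply Rabs_le. lra. }
  assert (I2 : Rabs (RInt (fun t => Q (u + h) t - Q u t) v (v + k) - (b * h) * (v + k - v))
               <= e * (h + k) * (v + k - v)).
  { apply RInt_near_const; [lra| |].
    - apply (ex_RInt_minus (V := R_NormedModule)); apply (ex_RInt_vertical P Q X); trivial; lra.
    - intros t Ht. pose proof (K2 u t ltac:(lra) Ht) as E1.
      pose proof (K2 (u + h) t ltac:(lra) Ht) as E2.
      apply Rabs_le_between in E1. apply Rabs_le_between in E2. apply Rabs_le. lra. }
  unfold boundary_integral.
  apply Rabs_le_between in I1. apply Rabs_le_between in I2. apply Rabs_le. nra.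
Qed.

(** If the integral were nonzero, bisection would keep a fixed fraction of it
    per unit of area in arbitrarily small rectangles around one point, against
    [boundary_integral_small]. *)
Theorem goursat_rectangle (P Q : R -> R -> R) (X x y h k : R) :
  closed_form P Q X -> 0 < h -> 0 < k -> x + h < X ->
  boundary_integral P Q x y h k = 0.
Proof.
  intros Hcl Hh Hk HX.
  destruct (Req_dec (boundary_integral P Q x y h k) 0) as [E|E]; [exact E|exfalso].
  (* the factor 1/2 makes the inequality in Bad strict at s = 1 *)
  set (e := Rabs (boundary_integral P Q x y h k) / 2).
  assert (He : 0 < e) by (unfold e; apply Rabs_pos_lt in E; lra).
  pose (Bad := fun u v s => 0 < s /\ u + h * s < X /\
     e * s ^ 2 < Rabs (boundary_integral P Q u v (h * s) (k * s))).
  destruct (rectangle_bisection h k Bad x y) as (p & q & Hpq); try lra.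
  - intros u v s (Hs & Hu & HB).
    set (s' := s / 2) in *.
    assert (Es : s = 2 * s') by (unfold s'; field).
    rewrite Es in HB.
    replace (h * (2 * s')) with (2 * (h * s')) in HB by ring.
    replace (k * (2 * s')) with (2 * (k * s')) in HB by ring.
    assert (Hhs : 0 < h * s') by (apply Rmult_lt_0_compat; lra).
    rewrite (boundary_integral_split P Q X) in HB by (trivial; rewrite Es in Hu; lra).
    assert (B : forall i j, (i = u \/ i = u + h * s') -> (j = v \/ j = v + k * s') ->
      e * s' ^ 2 < Rabs (boundary_integral P Q i j (h * s') (k * s')) ->
      exists x' y', (x' = u \/ x' = u + h * s') /\ (y' = v \/ y' = v + k * s') /\
      Bad x' y' s').
    { intros i j Hi Hj HH. exists i, j. split; [exact Hi|]. split; [exact Hj|].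
      split; [unfold s'; lra|]. split; [|exact HH].
      rewrite Es in Hu. destruct Hi; lra. }
    destruct (Rlt_dec (e * s' ^ 2) (Rabs (boundary_integral P Q u v (h * s') (k * s'))));
      [now apply (B u v); auto|].
    destruct (Rlt_dec (e * s' ^ 2) (Rabs (boundary_integral P Q (u + h * s') v (h * s') (k * s'))));
      [now apply (B (u + h * s') v); auto|].
    destruct (Rlt_dec (e * s' ^ 2) (Rabs (boundary_integral P Q u (v + k * s') (h * s') (k * s'))));
      [now apply (B u (v + k * s')); auto|].
    destruct (Rlt_dec (e * s' ^ 2) (Rabs (boundary_integral P Q (u + h * s') (v + k * s') (h * s') (k * s'))));
      [now apply (B (u + h * s') (v + k * s')); auto|].
    exfalso.
    match type of HB with _ < Rabs (?A + ?B + (?C + ?D)) =>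
      pose proof (Rabs_triang (A + B) (C + D)); pose proof (Rabs_triang A B);
      pose proof (Rabs_triang C D) end.
    replace (e * (2 * s') ^ 2) with (4 * (e * s' ^ 2)) in HB by ring. lra.
  - split; [lra|]. rewrite !Rmult_1_r. split; [exact HX|].
    unfold e in *. lra.
  - assert (HpX : p < X).
    { destruct (Hpq 0%nat) as (u & v & (_ & Hu & _) & Hp & _). simpl in *. lra. }
    set (e' := e / (2 * (h + k) ^ 2)).
    assert (Hsq : 0 < (h + k) ^ 2) by (apply pow_lt; lra).
    assert (He' : 0 < e') by (unfold e'; apply Rdiv_lt_0_compat; lra).
    destruct (boundary_integral_small P Q X p q e' Hcl HpX He') as (dl & Hdl & Hsm).
    destruct (nfloor_ex ((h + k) / dl)) as [N HN].
    { apply Rlt_le, Rdiv_lt_0_compat; lra. }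
    assert (HN2 : (h + k) / dl < 2 ^ S N).
    { eapply Rlt_trans; [apply HN|]. rewrite <- S_INR.
      assert (G : forall m, INR m < 2 ^ m).
      { induction m as [|m IH]; [simpl; lra|]. rewrite S_INR. simpl.
        assert (1 <= 2 ^ m) by (apply pow_R1_Rle; lra). lra. }
      apply G. }
    destruct (Hpq (S N)) as (u & v & (Hs & Hu & HB) & Hp & Hq).
    set (s := / 2 ^ S N) in *.
    assert (H2 : 0 < 2 ^ S N) by (apply pow_lt; lra).
    assert (Hsd : h * s + k * s < dl).
    { unfold s. rewrite <- Rmult_plus_distr_r.
      apply (Rmult_lt_reg_r (2 ^ S N)); [exact H2|].
      rewrite Rmult_assoc, Rinv_l, Rmult_1_r by lra.
      apply (Rmult_lt_compat_r dl) in HN2; [|lra].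
      unfold Rdiv in HN2. rewrite Rmult_assoc, Rinv_l in HN2 by lra. lra. }
    assert (hs : 0 < h * s) by (apply Rmult_lt_0_compat; lra).
    assert (ks : 0 < k * s) by (apply Rmult_lt_0_compat; lra).
    specialize (Hsm u v (h * s) (k * s) ltac:(lra) ltac:(lra) Hp Hq Hu Hsd).
    replace (e' * (h * s + k * s) ^ 2) with (e * s ^ 2 / 2) in Hsm
      by (unfold e'; field; lra).
    assert (0 < e * s ^ 2) by (apply Rmult_lt_0_compat; [lra|apply pow_lt; lra]).
    lra.
Qed.

(** For a form periodic in y the two horizontal sides cancel, and only the
    difference of the integrals over the vertical sides is left. *)
Corollary periodic_integral_constant (P Q : R -> R -> R) (X T x1 x2 : R) :
  closed_form P Q X ->
  0 < T -> (forall x y, P x (y + T) = P x y) -> x1 < x2 -> x2 < X ->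
  RInt (Q x1) 0 T = RInt (Q x2) 0 T.
Proof.
  intros Hcl HT Hper Hx HX.
  pose proof (goursat_rectangle P Q X x1 0 (x2 - x1) T Hcl ltac:(lra) HT ltac:(lra)) as H.
  rewrite (boundary_integral_expand P Q X) in H by (trivial; lra).
  rewrite (RInt_ext (fun t => P t (0 + T)) (fun t => P t 0)) in H
    by (intros; apply Hper).
  replace (x1 + (x2 - x1)) with x2 in H by ring. rewrite Rplus_0_l in H.
  change (RInt (fun t => Q x1 t) 0 T = RInt (fun t => Q x2 t) 0 T). lra.
Qed.

(** * Complex differentiation *)

Lemma Cmod_minus_sym (x y : C) : Cmod (x - y) = Cmod (y - x).
Proof. rewrite <- Cmod_opp. f_equal. ring. Qed.

Lemma Cmod_triangle_inv (x y : C) : Cmod x - Cmod y <= Cmod (x - y).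
Proof.
  pose proof (Cmod_triangle (x - y) y) as H.
  replace (x - y + y)%C with x in H by ring. lra.
Qed.

Lemma Cmod_le_Rabs (z : C) : Cmod z <= Rabs (Re z) + Rabs (Im z).
Proof.
  destruct z as [a b]. simpl.
  replace ((a, b) : C) with (RtoC a + Ci * RtoC b)%C
    by (unfold Cplus, Cmult, Ci, RtoC; simpl; f_equal; ring).
  eapply Rle_trans; [apply Cmod_triangle|].
  rewrite Cmod_mult, Cmod_Ci, !Cmod_R. lra.
Qed.

Lemma im_le_Cmod (z : C) : Rabs (Im z) <= Cmod z.
Proof. eapply Rle_trans; [apply Rmax_r|apply Rmax_Cmod]. Qed.

Lemma sqrt_2_le_2 : sqrt 2 <= 2.
Proof. rewrite <- (sqrt_pow2 2) at 2 by lra. apply sqrt_le_1_alt. lra. Qed.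

Lemma Cmult_conj_unit (z : C) : Cmod z = 1 -> (z * Cconj z)%C = RtoC 1.
Proof. intro H. rewrite <- Cmod2_conj, H. f_equal. ring. Qed.

(** Rotating a complex number to the positive half-line turns estimates of
    moduli into estimates of real parts. *)
Lemma exists_rotation (d : C) : exists u, Cmod u = 1 /\ (u * d)%C = RtoC (Cmod d).
Proof.
  destruct (Ceq_dec d (RtoC 0)) as [->|Hd].
  - exists (RtoC 1). rewrite Cmod_1, Cmod_0. split; [reflexivity|ring].
  - assert (Hm := proj1 (Cmod_gt_0 d) Hd).
    assert (Hn : RtoC (Cmod d) <> RtoC 0) by (intro E; apply RtoC_inj in E; lra).
    exists (Cconj d / RtoC (Cmod d))%C. split.
    + rewrite Cmod_div, Cmod_conj, Cmod_R, Rabs_right by (trivial; lra). field. lra.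
    + unfold Cdiv. replace (Cconj d * / RtoC (Cmod d) * d)%C with (d * Cconj d * / RtoC (Cmod d))%C by ring.
      rewrite <- Cmod2_conj. rewrite <- RtoC_inv by lra. rewrite <- RtoC_mult. f_equal. field. lra.
Qed.

Notation cder := (@is_derive C_AbsRing C_NormedModule).

Definition cdiff (g : C -> C) (z : C) : Prop := exists d, cder g z d.

(** The filters in the definition of [is_derive] use the uniform structure of
    the absolute ring, whose balls are those of [Cmod]. *)
Lemma cder_iff (g : C -> C) (z d : C) :
  cder g z d <->
  forall eps, 0 < eps -> exists delta, 0 < delta /\ forall h, Cmod h < delta ->
    Cmod (g (z + h) - g z - d * h)%C <= eps * Cmod h.
Proof.
  split.
  - intros [_ H] eps He.
    destruct (H z (fun P HP => HP) (mkposreal _ He)) as [dl Hd].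
    exists dl. split; [apply cond_pos|]. intros h Hh.
    assert (K : Cmod (z + h - z) < dl ->
      Cmod (g (z + h) - g z - (z + h - z) * d)%C <= eps * Cmod (z + h - z)%C)
      by exact (Hd (z + h)%C).
    replace (z + h - z)%C with h in K by ring.
    replace (d * h)%C with (h * d)%C by ring. now apply K.
  - intro H. split; [apply is_linear_scal_l|].
    intros y Hy.
    rewrite <- (@is_filter_lim_locally_unique C_AbsRing (AbsRing_NormedModule C_AbsRing) z y Hy).
    intros eps. destruct (H eps (cond_pos eps)) as (dl & Hdl & Hd).
    exists (mkposreal _ Hdl). intros w Hw.
    change (Cmod (w - z)%C < dl) in Hw.
    change (Cmod (g w - g z - (w - z) * d)%C <= eps * Cmod (w - z)%C).
    specialize (Hd (w - z)%C Hw).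
    replace (z + (w - z))%C with (w : C) in Hd by (change C in w; ring).
    now rewrite (Cmult_comm _ d).
Qed.

(** The complex numbers carry two normed module structures over themselves,
    with the same norm but different uniform structures.  The product and chain
    rules are stated for one and [holomorphic_on] uses the other. *)
Lemma cder_absring (g : C -> C) (z d : C) :
  cder g z d <-> @is_derive C_AbsRing (AbsRing_NormedModule C_AbsRing) g z d.
Proof.
  split; intros [_ H]; (split; [apply is_linear_scal_l | exact H]).
Qed.

Lemma cder_C_derive (g : C -> C) (z : C) :
  @ex_derive C_AbsRing C_NormedModule g z -> cder g z (C_derive g z).
Proof. exact (C_derive_correct g z z). Qed.

Lemma cdiff_cder f z : cdiff f z -> cder f z (C_derive f z).
Proof. intros H. apply cder_C_derive. destruct H as [d Hd]. now exists d. Qed.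

Lemma cder_eq (g : C -> C) (z d d' : C) : cder g z d -> d = d' -> cder g z d'.
Proof. now intros H <-. Qed.

Lemma cder_ext_disc (f g : C -> C) (z d : C) (r : R) :
  0 < r -> (forall w, Cmod (w - z) < r -> f w = g w) -> cder f z d -> cder g z d.
Proof.
  intros Hr E Hf. apply (is_derive_ext_loc (V := C_NormedModule) f); [|exact Hf].
  exists (mkposreal r Hr). intros w Hw. now apply E.
Qed.

Lemma cder_continuous (g : C -> C) (z d : C) :
  cder g z d ->
  forall eps, 0 < eps -> exists delta, 0 < delta /\ forall h, Cmod h < delta ->
    Cmod (g (z + h) - g z)%C < eps.
Proof.
  intros H eps He. destruct (proj1 (cder_iff g z d) H 1 Rlt_0_1) as (dl & Hdl & Hd).
  assert (Hm := Cmod_ge_0 d).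
  exists (Rmin dl (eps / (2 + Cmod d))). split.
  - apply Rmin_pos; [lra|]. apply Rdiv_lt_0_compat; lra.
  - intros h Hh.
    assert (H1 : Cmod h < dl) by (eapply Rlt_le_trans; [exact Hh|apply Rmin_l]).
    assert (H2 : Cmod h < eps / (2 + Cmod d)) by (eapply Rlt_le_trans; [exact Hh|apply Rmin_r]).
    specialize (Hd h H1).
    replace (g (z + h) - g z)%C with ((g (z + h) - g z - d * h) + d * h)%C by ring.
    eapply Rle_lt_trans; [apply Cmod_triangle|]. rewrite Cmod_mult.
    apply (Rmult_lt_compat_r (2 + Cmod d)) in H2; [|lra].
    unfold Rdiv in H2. rewrite Rmult_assoc, Rinv_l in H2 by lra.
    assert (Hh0 := Cmod_ge_0 h). nra.
Qed.

Lemma cder_const (c z : C) : cder (fun _ => c) z (RtoC 0).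
Proof. exact (is_derive_const (V := C_NormedModule) c z). Qed.

Lemma cder_id (z : C) : cder (fun w => w) z (RtoC 1).
Proof. apply cder_absring. exact (is_derive_id (K := C_AbsRing) z). Qed.

Lemma cder_plus (f g : C -> C) (z df dg : C) :
  cder f z df -> cder g z dg -> cder (fun w => f w + g w)%C z (df + dg)%C.
Proof. exact (is_derive_plus (V := C_NormedModule) f g z df dg). Qed.

Lemma cder_opp (f : C -> C) (z df : C) :
  cder f z df -> cder (fun w => - f w)%C z (- df)%C.
Proof. exact (is_derive_opp (V := C_NormedModule) f z df). Qed.

Lemma cder_minus (f g : C -> C) (z df dg : C) :
  cder f z df -> cder g z dg -> cder (fun w => f w - g w)%C z (df - dg)%C.
Proof. exact (is_derive_minus (V := C_NormedModule) f g z df dg). Qed.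

Lemma cder_mult (f g : C -> C) (z df dg : C) :
  cder f z df -> cder g z dg ->
  cder (fun w => f w * g w)%C z (df * g z + f z * dg)%C.
Proof.
  rewrite !cder_absring. intros Hf Hg.
  exact (is_derive_mult (K := C_AbsRing) f g z df dg Hf Hg Cmult_comm).
Qed.

Lemma cder_comp (f g : C -> C) (z df dg : C) :
  cder f (g z) df -> cder g z dg -> cder (fun w => f (g w)) z (dg * df)%C.
Proof.
  intros Hf Hg. apply cder_absring in Hg.
  exact (is_derive_comp (V := C_NormedModule) f g z df dg Hf Hg).
Qed.

Lemma cder_inv_id (z : C) : z <> RtoC 0 -> cder Cinv z (- / (z * z))%C.
Proof.
  intro Hz. apply cder_iff. intros eps He.
  assert (Hm := proj1 (Cmod_gt_0 z) Hz).
  set (m := Cmod z) in *.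
  exists (Rmin (m / 2) (eps * m ^ 3 / 2)). split.
  - assert (0 < m ^ 3) by now apply pow_lt. apply Rmin_pos; [lra|]. nra.
  - intros h Hh.
    assert (H1 : Cmod h < m / 2) by (eapply Rlt_le_trans; [exact Hh|apply Rmin_l]).
    assert (H2 : Cmod h < eps * m ^ 3 / 2) by (eapply Rlt_le_trans; [exact Hh|apply Rmin_r]).
    assert (H3 : m / 2 <= Cmod (z + h)).
    { pose proof (Cmod_triangle_inv z (- h)) as T. rewrite Cmod_opp in T.
      fold m in T. replace (z - - h)%C with (z + h)%C in T by ring. lra. }
    assert (Hn : (z + h)%C <> RtoC 0).
    { intro E. rewrite E, Cmod_0 in H3. lra. }
    replace (/ (z + h) - / z - - / (z * z) * h)%C with (h * h / ((z + h) * (z * z)))%C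
      by (field; split; trivial; now apply Cmult_neq_0).
    rewrite Cmod_div by (repeat apply Cmult_neq_0; trivial).
    rewrite !Cmod_mult. fold m.
    assert (Hd : 0 < Cmod (z + h) * (m * m)) by (repeat apply Rmult_lt_0_compat; lra).
    apply Rmult_le_reg_r with (1 := Hd). unfold Rdiv.
    rewrite Rmult_assoc, Rinv_l by lra.
    rewrite Rmult_1_r, Rmult_assoc, (Rmult_comm eps), Rmult_assoc.
    apply Rmult_le_compat_l; [apply Cmod_ge_0|].
    assert (m / 2 * (m * m) <= Cmod (z + h) * (m * m)) by (apply Rmult_le_compat_r; nra).
    nra.
Qed.

Lemma cder_inv (g : C -> C) (z d : C) :
  g z <> RtoC 0 -> cder g z d -> cder (fun w => / g w)%C z (d * - / (g z * g z))%C.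
Proof. intros Hz Hg. apply (cder_comp Cinv g); [now apply cder_inv_id|exact Hg]. Qed.

Lemma cder_div (f g : C -> C) (z df dg : C) :
  g z <> RtoC 0 -> cder f z df -> cder g z dg ->
  cder (fun w => f w / g w)%C z (df * / g z + f z * (dg * - / (g z * g z)))%C.
Proof.
  intros Hz Hf Hg. apply (cder_mult f (fun w => / g w)%C); trivial. now apply cder_inv.
Qed.

Lemma cder_pow (n : nat) (z : C) :
  cder (fun w => w ^ S n)%C z (RtoC (INR (S n)) * z ^ n)%C.
Proof.
  induction n as [|n IH].
  - eapply cder_eq; [apply (cder_mult (fun w => w) (fun _ => RtoC 1)); [apply cder_id|apply cder_const]|].
    simpl. ring.
  - eapply cder_eq; [apply (cder_mult (fun w => w) (fun w => w ^ S n)%C); [apply cder_id|exact IH]|].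
    rewrite (S_INR (S n)), RtoC_plus, Cpow_S. ring.
Qed.

Lemma cdiff_const c z : cdiff (fun _ => c) z.
Proof. eexists. apply cder_const. Qed.

Lemma cdiff_id z : cdiff (fun w => w) z.
Proof. eexists. apply cder_id. Qed.

Lemma cdiff_plus f g z : cdiff f z -> cdiff g z -> cdiff (fun w => f w + g w)%C z.
Proof. intros [a Ha] [b Hb]. eexists. apply cder_plus; eassumption. Qed.

Lemma cdiff_opp f z : cdiff f z -> cdiff (fun w => - f w)%C z.
Proof. intros [a Ha]. eexists. apply cder_opp; eassumption. Qed.

Lemma cdiff_minus f g z : cdiff f z -> cdiff g z -> cdiff (fun w => f w - g w)%C z.
Proof. intros [a Ha] [b Hb]. eexists. apply cder_minus; eassumption. Qed.

Lemma cdiff_mult f g z : cdiff f z -> cdiff g z -> cdiff (fun w => f w * g w)%C z.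
Proof. intros [a Ha] [b Hb]. eexists. apply cder_mult; eassumption. Qed.

Lemma cdiff_div f g z : g z <> RtoC 0 -> cdiff f z -> cdiff g z -> cdiff (fun w => f w / g w)%C z.
Proof. intros Hz [a Ha] [b Hb]. eexists. apply cder_div; eassumption. Qed.

Lemma cdiff_comp f g z : cdiff f (g z) -> cdiff g z -> cdiff (fun w => f (g w)) z.
Proof. intros [a Ha] [b Hb]. eexists. apply (cder_comp f g); eassumption. Qed.

Ltac cdiff_rules := repeat
  match goal with
  | H : cdiff ?f ?z |- cdiff ?f ?z => exact H
  | |- cdiff (fun w => w) _ => apply cdiff_id
  | |- cdiff (fun _ => ?c) _ => apply cdiff_const
  | |- cdiff (fun w => @?f w + @?g w)%C _ => apply (cdiff_plus f g)
  | |- cdiff (fun w => @?f w - @?g w)%C _ => apply (cdiff_minus f g)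
  | |- cdiff (fun w => @?f w * @?g w)%C _ => apply (cdiff_mult f g)
  end.

(** * The complex exponential *)

Lemma Cexp_plus (z w : C) : Cexp (z + w) = (Cexp z * Cexp w)%C.
Proof.
  destruct z as [a b], w as [c d]. unfold Cexp, Cplus, Cmult, Re, Im; simpl.
  rewrite exp_plus, cos_plus, sin_plus. f_equal; ring.
Qed.

Lemma Cexp_0 : Cexp (RtoC 0) = RtoC 1.
Proof.
  unfold Cexp, RtoC; simpl. rewrite exp_0, cos_0, sin_0. f_equal; ring.
Qed.

Lemma Cmod_Cexp (z : C) : Cmod (Cexp z) = exp (Re z).
Proof.
  unfold Cexp, Cmod; simpl.
  replace (_ + _) with (exp (Re z) ^ 2).
  - apply sqrt_pow2. left. apply exp_pos.
  - pose proof (sin2_cos2 (Im z)) as H. unfold Rsqr in H.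
    transitivity (exp (Re z) ^ 2 * (sin (Im z) * sin (Im z) + cos (Im z) * cos (Im z)));
      [rewrite H|]; ring.
Qed.

Lemma Cexp_neq_0 (z : C) : Cexp z <> RtoC 0.
Proof. apply Cmod_gt_0. rewrite Cmod_Cexp. apply exp_pos. Qed.

(** Componentwise, with exp, cos and sin replaced by their linear parts at 0;
    the addition formula then carries the derivative to every point. *)
Lemma cder_Cexp_0 : cder Cexp (RtoC 0) (RtoC 1).
Proof.
  apply cder_iff. intros eps He. rewrite Cexp_0.
  set (e := Rmin 1 (eps / 8)).
  assert (He1 : 0 < e) by (apply Rmin_pos; lra).
  assert (He2 : e <= 1) by apply Rmin_l.
  assert (He3 : e <= eps / 8) by apply Rmin_r.
  clearbody e.
  assert (D : forall (g : R -> R) d, derivable_pt_lim g 0 d -> exists delta, 0 < delta /\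
    forall t, Rabs t < delta -> Rabs (g t - g 0 - d * t) <= e * Rabs t).
  { intros g d H. destruct (H e He1) as [dl Hd]. exists dl. split; [apply cond_pos|].
    intros t Ht. destruct (Req_dec t 0) as [->|N].
    - replace (g 0 - g 0 - d * 0) with 0 by ring. rewrite Rabs_R0. lra.
    - specialize (Hd t N Ht). rewrite Rplus_0_l in Hd.
      replace (g t - g 0 - d * t) with (((g t - g 0) / t - d) * t) by (field; trivial).
      rewrite Rabs_mult. apply Rmult_le_compat_r; [apply Rabs_pos|lra]. }
  destruct (D exp 1) as (d1 & P1 & H1); [rewrite <- exp_0; apply derivable_pt_lim_exp|].
  destruct (D cos (- sin 0)) as (d2 & P2 & H2); [apply derivable_pt_lim_cos|].
  destruct (D sin (cos 0)) as (d3 & P3 & H3); [apply derivable_pt_lim_sin|].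
  rewrite exp_0 in H1. rewrite cos_0, sin_0 in H2. rewrite cos_0, sin_0 in H3.
  exists (Rmin e (Rmin d1 (Rmin d2 d3))). split; [repeat apply Rmin_pos; trivial|].
  intros h Hh. destruct (Rmin_Rgt_l _ _ _ Hh) as [K0 Hh1].
  destruct (Rmin_Rgt_l _ _ _ Hh1) as [K1 Hh2]. destruct (Rmin_Rgt_l _ _ _ Hh2) as [K2 K3].
  pose proof (re_le_Cmod h) as R1. pose proof (im_le_Cmod h) as R2.
  destruct h as [x y]. simpl in R1, R2. set (m := Cmod (x, y)) in *.
  assert (A1 : Rabs (exp x - 1 - 1 * x) <= e * m).
  { eapply Rle_trans; [apply H1; lra|]. apply Rmult_le_compat_l; lra. }
  assert (A2 : Rabs (cos y - 1 - - 0 * y) <= e * m).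
  { eapply Rle_trans; [apply H2; lra|]. apply Rmult_le_compat_l; lra. }
  assert (A3 : Rabs (sin y - 0 - 1 * y) <= e * m).
  { eapply Rle_trans; [apply H3; lra|]. apply Rmult_le_compat_l; lra. }
  rewrite Cplus_0_l.
  assert (Hm : 0 <= m) by apply Cmod_ge_0.
  apply Rabs_le_between in A1. apply Rabs_le_between in A2. apply Rabs_le_between in A3.
  apply Rabs_le_between in R1. apply Rabs_le_between in R2.
  pose proof (COS_bound y) as Cb.
  eapply Rle_trans; [apply Cmod_le_Rabs|].
  unfold Cexp, Cminus, Cplus, Copp, Cmult, RtoC, Re, Im; simpl.
  replace (exp x * cos y + - (1) + - (1 * x - 0 * y)) with
    ((exp x - 1 - 1 * x) * cos y + (1 + x) * (cos y - 1)) by ring.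
  replace (exp x * sin y + - 0 + - (1 * y + 0 * x)) with
    ((exp x - 1) * sin y + (sin y - y)) by ring.
  assert (B1 : Rabs ((exp x - 1 - 1 * x) * cos y + (1 + x) * (cos y - 1)) <= 3 * (e * m)).
  { eapply Rle_trans; [apply Rabs_triang|]. rewrite !Rabs_mult.
    assert (Rabs (exp x - 1 - 1 * x) <= e * m) by (apply Rabs_le; lra).
    assert (Rabs (cos y) <= 1) by (apply Rabs_le; lra).
    assert (Rabs (1 + x) <= 2) by (apply Rabs_le; lra).
    assert (Rabs (cos y - 1) <= e * m) by (apply Rabs_le; lra).
    pose proof (Rabs_pos (exp x - 1 - 1 * x)). pose proof (Rabs_pos (cos y - 1)).
    pose proof (Rabs_pos (cos y)). pose proof (Rabs_pos (1 + x)). nra. }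
  assert (B2 : Rabs ((exp x - 1) * sin y + (sin y - y)) <= 5 * (e * m)).
  { eapply Rle_trans; [apply Rabs_triang|]. rewrite !Rabs_mult.
    assert (e * m <= m) by nra.
    assert (Rabs (exp x - 1) <= 2 * m) by (apply Rabs_le; lra).
    assert (Rabs (sin y) <= 2 * e) by (apply Rabs_le; lra).
    assert (Rabs (sin y - y) <= e * m) by (apply Rabs_le; lra).
    pose proof (Rabs_pos (exp x - 1)). pose proof (Rabs_pos (sin y)). nra. }
  nra.
Qed.

Lemma cder_Cexp (z : C) : cder Cexp z (Cexp z).
Proof.
  apply (cder_ext_disc (fun w => Cexp z * Cexp (w - z))%C Cexp z _ 1 Rlt_0_1).
  - intros w _. rewrite <- Cexp_plus. f_equal. ring.
  - eapply cder_eq.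
    + apply cder_mult; [apply cder_const|].
      apply (cder_comp Cexp (fun w => w - z)%C).
      * replace (z - z)%C with (RtoC 0) by ring. apply cder_Cexp_0.
      * apply cder_minus; [apply cder_id|apply cder_const].
    + simpl. ring.
Qed.

(** * Limits at 0 *)

(** Power series expansions are expressed below by limits of divided remainders,
    such as (g(z) - a - b z) / z^2, which mean nothing at z = 0; hence the
    punctured neighbourhood. *)
Definition tends0 (g : C -> C) (c : C) : Prop :=
  forall eps, 0 < eps -> exists delta, 0 < delta /\
    forall z, z <> RtoC 0 -> Cmod z < delta -> Cmod (g z - c)%C < eps.

Lemma tends0_ext (g k : C -> C) c :
  tends0 g c -> (exists r, 0 < r /\ forall z, z <> RtoC 0 -> Cmod z < r -> g z = k z) ->
  tends0 k c.
Proof.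
  intros H (r & Hr & E) eps He. destruct (H eps He) as (dl & Hdl & Hd).
  exists (Rmin dl r). split; [now apply Rmin_pos|]. intros z Hz Hzd.
  destruct (Rmin_Rgt_l _ _ _ Hzd). rewrite <- E by trivial. now apply Hd.
Qed.

Lemma tends0_eq (g : C -> C) c c' : tends0 g c -> c = c' -> tends0 g c'.
Proof. now intros H <-. Qed.

Lemma tends0_unique (g : C -> C) c c' : tends0 g c -> tends0 g c' -> c = c'.
Proof.
  intros H H'. destruct (Ceq_dec c c') as [E|N]; [exact E|exfalso].
  assert (P : 0 < Cmod (c - c')%C) by (apply Cmod_gt_0; now apply Cminus_eq_contra).
  destruct (H (Cmod (c - c') / 2) ltac:(lra)) as (d1 & P1 & K1).
  destruct (H' (Cmod (c - c') / 2) ltac:(lra)) as (d2 & P2 & K2).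
  set (t := Rmin d1 d2 / 2). assert (Pm := Rmin_pos _ _ P1 P2).
  assert (T : Cmod (RtoC t) = t) by (rewrite Cmod_R; apply Rabs_right; unfold t; lra).
  assert (Tn : RtoC t <> RtoC 0) by (apply Cmod_gt_0; rewrite T; unfold t; lra).
  assert (L1 := Rmin_l d1 d2). assert (L2 := Rmin_r d1 d2).
  specialize (K1 _ Tn ltac:(rewrite T; unfold t; lra)).
  specialize (K2 _ Tn ltac:(rewrite T; unfold t; lra)).
  rewrite Cmod_minus_sym in K1.
  pose proof (Cmod_triangle (c - g (RtoC t)) (g (RtoC t) - c')) as K.
  replace (c - g (RtoC t) + (g (RtoC t) - c'))%C with (c - c')%C in K by ring. lra.
Qed.

Lemma tends0_const c : tends0 (fun _ => c) c.
Proof.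
  intros eps He. exists 1. split; [lra|]. intros z _ _.
  replace (c - c)%C with (RtoC 0) by ring. now rewrite Cmod_0.
Qed.

Lemma tends0_id : tends0 (fun z => z) (RtoC 0).
Proof.
  intros eps He. exists eps. split; [lra|]. intros z _ H.
  now replace (z - 0)%C with z by ring.
Qed.

Lemma tends0_plus f g a b : tends0 f a -> tends0 g b -> tends0 (fun z => f z + g z)%C (a + b)%C.
Proof.
  intros Hf Hg eps He.
  destruct (Hf (eps / 2) ltac:(lra)) as (d1 & P1 & K1).
  destruct (Hg (eps / 2) ltac:(lra)) as (d2 & P2 & K2).
  exists (Rmin d1 d2). split; [now apply Rmin_pos|]. intros z Hz Hd.
  destruct (Rmin_Rgt_l _ _ _ Hd) as [E1 E2]. specialize (K1 z Hz E1). specialize (K2 z Hz E2).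
  replace (f z + g z - (a + b))%C with ((f z - a) + (g z - b))%C by ring.
  eapply Rle_lt_trans; [apply Cmod_triangle|]. lra.
Qed.

Lemma tends0_mult f g a b : tends0 f a -> tends0 g b -> tends0 (fun z => f z * g z)%C (a * b)%C.
Proof.
  intros Hf Hg eps He.
  assert (Ha := Cmod_ge_0 a). assert (Hb := Cmod_ge_0 b).
  set (e := Rmin 1 (eps / (2 + Cmod a + Cmod b))).
  assert (He1 : 0 < e) by (apply Rmin_pos; [lra|apply Rdiv_lt_0_compat; lra]).
  assert (He2 : e <= 1) by apply Rmin_l.
  assert (He3 : e * (2 + Cmod a + Cmod b) <= eps).
  { apply Rle_trans with (eps / (2 + Cmod a + Cmod b) * (2 + Cmod a + Cmod b)).
    - apply Rmult_le_compat_r; [lra|apply Rmin_r].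
    - right. field. lra. }
  destruct (Hf e He1) as (d1 & P1 & K1). destruct (Hg e He1) as (d2 & P2 & K2).
  exists (Rmin d1 d2). split; [now apply Rmin_pos|]. intros z Hz Hd.
  destruct (Rmin_Rgt_l _ _ _ Hd) as [E1 E2]. specialize (K1 z Hz E1). specialize (K2 z Hz E2).
  replace (f z * g z - a * b)%C with ((f z - a) * (g z - b) + (a * (g z - b) + (f z - a) * b))%C by ring.
  eapply Rle_lt_trans; [apply Cmod_triangle|].
  eapply Rle_lt_trans; [apply Rplus_le_compat_l, Cmod_triangle|].
  rewrite !Cmod_mult.
  pose proof (Cmod_ge_0 (f z - a)). pose proof (Cmod_ge_0 (g z - b)). nra.
Qed.

Lemma tends0_minus f g a b : tends0 f a -> tends0 g b -> tends0 (fun z => f z - g z)%C (a - b)%C.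
Proof.
  intros Hf Hg.
  eapply tends0_eq; [eapply tends0_ext; [apply tends0_plus; [exact Hf|
    apply (tends0_mult _ _ _ _ (tends0_const (- RtoC 1)%C) Hg)]|]|].
  - exists 1. split; [lra|]. intros z _ _. simpl. ring.
  - ring.
Qed.

Lemma tends0_comp (g k : C -> C) (b d : C) :
  cder k b d -> tends0 g b -> tends0 (fun z => k (g z)) (k b).
Proof.
  intros Hk Hg eps He.
  destruct (cder_continuous k b d Hk eps He) as (d1 & P1 & K1).
  destruct (Hg d1 P1) as (d2 & P2 & K2).
  exists d2. split; [exact P2|]. intros z Hz Hd.
  specialize (K1 _ (K2 z Hz Hd)). now replace (b + (g z - b))%C with (g z) in K1 by ring.
Qed.

Lemma tends0_div f g a b : b <> RtoC 0 ->
  tends0 f a -> tends0 g b -> tends0 (fun z => f z / g z)%C (a / b)%C.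
Proof.
  intros Hb Hf Hg. apply tends0_mult; [exact Hf|].
  exact (tends0_comp g Cinv b _ (cder_inv_id b Hb) Hg).
Qed.

Ltac tends0_rules := repeat
  match goal with
  | H : tends0 ?f _ |- tends0 ?f _ => exact H
  | |- tends0 (fun w => w) _ => apply tends0_id
  | |- tends0 (fun _ => ?c) _ => apply tends0_const
  | |- tends0 (fun w => @?f w + @?g w)%C _ => eapply (tends0_plus f g)
  | |- tends0 (fun w => @?f w - @?g w)%C _ => eapply (tends0_minus f g)
  | |- tends0 (fun w => @?f w * @?g w)%C _ => eapply (tends0_mult f g)
  end.

(** The inner function has to avoid 0, where g is not controlled. *)
Lemma tends0_subst (g k : C -> C) c r : 0 < r ->
  (forall z, z <> RtoC 0 -> Cmod z < r -> k z <> RtoC 0) ->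
  tends0 k (RtoC 0) -> tends0 g c -> tends0 (fun z => g (k z)) c.
Proof.
  intros Hr Hk0 Hk Hg eps He. destruct (Hg eps He) as (d1 & P1 & K1).
  destruct (Hk d1 P1) as (d2 & P2 & K2).
  exists (Rmin d2 r). split; [now apply Rmin_pos|]. intros z Hz Hd.
  destruct (Rmin_Rgt_l _ _ _ Hd) as [E1 E2].
  apply K1; [now apply Hk0|]. specialize (K2 z Hz E1).
  now replace (k z - 0)%C with (k z) in K2 by ring.
Qed.

(** Here the inner function may take the value 0, and g has to be continuous
    there. *)
Lemma tends0_subst_extended (g k : C -> C) (c : C) :
  g (RtoC 0) = c -> tends0 g c -> tends0 k (RtoC 0) -> tends0 (fun z => g (k z)) c.
Proof.
  intros E Hg Hk eps He. destruct (Hg eps He) as (d1 & P1 & K1).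
  destruct (Hk d1 P1) as (d2 & P2 & K2). exists d2. split; [exact P2|]. intros z Hz Hd.
  destruct (Ceq_dec (k z) (RtoC 0)) as [Z|N].
  - rewrite Z, E. replace (c - c)%C with (RtoC 0) by ring. now rewrite Cmod_0.
  - apply K1; trivial. specialize (K2 z Hz Hd).
    now replace (k z - 0)%C with (k z) in K2 by ring.
Qed.

Lemma tends0_scal (g : C -> C) c k : k <> RtoC 0 ->
  tends0 g c -> tends0 (fun z => g (k * z))%C c.
Proof.
  intros Hk Hg.
  apply (tends0_subst g (fun z => k * z)%C c 1 Rlt_0_1);
    [|apply tends0_eq with (k * 0)%C|exact Hg].
  - intros z Hz _. now apply Cmult_neq_0.
  - apply tends0_mult; [apply tends0_const|apply tends0_id].
  - ring.
Qed.

Lemma tends0_quotient (g : C -> C) (b d : C) :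
  cder g b d -> tends0 (fun z => (g (b + z) - g b) / z)%C d.
Proof.
  intros H eps He. destruct (proj1 (cder_iff g b d) H (eps / 2) ltac:(lra)) as (dl & Hdl & Hd).
  exists dl. split; [exact Hdl|]. intros z Hz Hzd. specialize (Hd z Hzd).
  replace ((g (b + z) - g b) / z - d)%C with ((g (b + z) - g b - d * z) / z)%C
    by (field; trivial).
  rewrite Cmod_div by trivial. assert (Hm := proj1 (Cmod_gt_0 z) Hz).
  apply Rle_lt_trans with (eps / 2); [|lra].
  apply Rmult_le_reg_r with (Cmod z); [exact Hm|]. unfold Rdiv at 1.
  rewrite Rmult_assoc, Rinv_l by lra. lra.
Qed.

Lemma tends0_cder (g : C -> C) (b d : C) :
  tends0 (fun z => (g (b + z) - g b) / z)%C d -> cder g b d.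
Proof.
  intros H. apply cder_iff. intros eps He. destruct (H eps He) as (dl & Hdl & Hd).
  exists dl. split; [exact Hdl|]. intros z Hzd.
  destruct (Ceq_dec z (RtoC 0)) as [->|Hz].
  - replace (b + 0)%C with b by ring. replace (g b - g b - d * 0)%C with (RtoC 0) by ring.
    rewrite Cmod_0. lra.
  - specialize (Hd z Hz Hzd).
    replace (g (b + z) - g b - d * z)%C with (((g (b + z) - g b) / z - d) * z)%C
      by (field; trivial).
    rewrite Cmod_mult. apply Rmult_le_compat_r; [apply Cmod_ge_0|lra].
Qed.

Lemma tends0_of_quotient (g : C -> C) (a b c : C) (n : nat) :
  tends0 (fun z => (g z - a - b * z) / z ^ S n)%C c -> tends0 g a.
Proof.
  intros H. eapply tends0_eq; [eapply tends0_ext|].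
  - apply (tends0_plus (fun z => a + b * z)%C (fun z => (g z - a - b * z) / z ^ S n * z ^ S n)%C).
    + apply tends0_plus; [apply tends0_const|]. apply tends0_mult; [apply tends0_const|apply tends0_id].
    + apply tends0_mult; [exact H|].
      eapply (tends0_comp (fun w => w) (fun w => w ^ S n)%C); [apply cder_pow|apply tends0_id].
  - exists 1. split; [lra|]. intros z Hz _. cbv beta.
    assert (N : (z ^ S n)%C <> RtoC 0) by now apply Cpow_nz.
    set (d := (z ^ S n)%C) in *. clearbody d. field. trivial.
  - rewrite Cpow_S. ring.
Qed.

(** The hypothesis is a Cauchy condition as h and k tend to 0; completeness
    provides the limit along the positive reals, and the same condition shows that it
    is the limit along all h. *)
Lemma lipschitz_at_0_limit (D : C -> C) (r M : R) :
  0 < r -> 0 <= M ->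
  (forall h k, h <> RtoC 0 -> k <> RtoC 0 -> Cmod h < r -> Cmod k < r ->
     Cmod (D h - D k) <= M * (Cmod h + Cmod k)) ->
  exists L, tends0 D L.
Proof.
  intros Hr HM H.
  destruct (proj1 (filterlim_locally_cauchy (U := C_CompleteNormedModule) (F := at_right 0)
     (fun t : R => D (RtoC t)))) as [L HL].
  - intros eps.
    set (e := Rmin r (eps / (2 * (M + 1)))).
    assert (He0 := cond_pos eps).
    assert (He : 0 < e) by (apply Rmin_pos; [lra|apply Rdiv_lt_0_compat; lra]).
    exists (fun t => 0 < t < e). split.
    + exists (mkposreal e He). intros t Ht Ht0.
      change (Rabs (t - 0) < e) in Ht. apply Rabs_lt_between in Ht. lra.
    + intros s t Hs Ht.
      assert (P : forall q, 0 < q < e -> RtoC q <> RtoC 0 /\ Cmod (RtoC q) = q).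
      { intros q Hq. split; [intro E; apply RtoC_inj in E; lra|].
        rewrite Cmod_R. apply Rabs_right. lra. }
      destruct (P s Hs) as [S1 S2]. destruct (P t Ht) as [T1 T2].
      assert (e <= r) by apply Rmin_l.
      assert (e * (2 * (M + 1)) <= eps).
      { apply Rle_trans with (eps / (2 * (M + 1)) * (2 * (M + 1))).
        - apply Rmult_le_compat_r; [lra|apply Rmin_r].
        - right. field. lra. }
      apply (C_NormedModule_mixin_compat1 (D (RtoC s)) (D (RtoC t)) eps).
      change (Cmod (D (RtoC t) - D (RtoC s)) < eps).
      eapply Rle_lt_trans; [apply H; trivial; lra|]. rewrite S2, T2. nra.
  - exists L. intros eps He.
    set (e := Rmin r (eps / (4 * (M + 1)))).
    assert (He1 : 0 < e) by (apply Rmin_pos; [lra|apply Rdiv_lt_0_compat; lra]).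
    assert (Her : e <= r) by apply Rmin_l.
    assert (Hee : e * (4 * (M + 1)) <= eps).
    { apply Rle_trans with (eps / (4 * (M + 1)) * (4 * (M + 1))).
      - apply Rmult_le_compat_r; [lra|apply Rmin_r].
      - right. field. lra. }
    exists e. split; [exact He1|]. intros z Hz Hze.
    assert (Hq : 0 < eps / 4) by lra.
    destruct (HL (fun w => ball (M := C_UniformSpace) L (mkposreal _ Hq) w)) as [dl Hdl].
    { exists (mkposreal _ Hq). trivial. }
    set (t := Rmin e dl / 2).
    assert (Hmn : 0 < Rmin e dl) by (apply Rmin_pos; [lra|apply cond_pos]).
    assert (M1 := Rmin_l e dl). assert (M2 := Rmin_r e dl).
    assert (Ht : 0 < t) by (unfold t; lra).
    assert (B : ball (M := C_UniformSpace) L (mkposreal _ Hq) (D (RtoC t))).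
    { apply Hdl; [|exact Ht]. change (Rabs (t - 0) < dl).
      rewrite Rminus_0_r, Rabs_right; unfold t; lra. }
    apply C_NormedModule_mixin_compat2 in B. change (Cmod (D (RtoC t) - L) < sqrt 2 * (eps / 4)) in B.
    pose proof sqrt_2_le_2 as S2.
    assert (T : Cmod (RtoC t) = t) by (rewrite Cmod_R; apply Rabs_right; lra).
    assert (Hb : Cmod (D z - D (RtoC t)) <= M * (Cmod z + Cmod (RtoC t))).
    { apply H; trivial; [intro E; apply RtoC_inj in E; lra|lra|rewrite T; unfold t; lra]. }
    rewrite T in Hb.
    replace (D z - L)%C with ((D z - D (RtoC t)) + (D (RtoC t) - L))%C by ring.
    eapply Rle_lt_trans; [apply Cmod_triangle|].
    assert (t < e) by (unfold t; lra). nra.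
Qed.

(** * The half-plane principle and Cauchy's estimate *)

(** Cauchy-Riemann: the imaginary part of G ds is v dx + u dy for G = u + iv, and it is
    closed because dv/dy = du/dx. *)
Lemma cder_closed_form (G : C -> C) (x y : R) (d : C) :
  cder G (x, y) d ->
  differentiable_pt_lim (fun u v => Im (G (u, v))) x y (Im d) (Re d) /\
  differentiable_pt_lim (fun u v => Re (G (u, v))) x y (Re d) (- Im d).
Proof.
  intro H.
  assert (K : forall eps : posreal, exists delta : posreal, forall u v,
    Rabs (u - x) < delta -> Rabs (v - y) < delta ->
    Cmod (G (u, v) - G (x, y) - d * ((u - x)%R, (v - y)%R))%C <= eps * Rmax (Rabs (u - x)) (Rabs (v - y))).
  { intro eps. assert (He := cond_pos eps).
    destruct (proj1 (cder_iff _ _ _) H (eps / 2) ltac:(lra)) as (dl & Hdl & Hd).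
    exists (mkposreal (dl / 2) ltac:(lra)). intros u v Hu Hv. simpl in Hu, Hv.
    set (h := ((u - x, v - y) : C)).
    assert (Hh : Cmod h <= Rabs (u - x) + Rabs (v - y)) by apply Cmod_le_Rabs.
    specialize (Hd h ltac:(lra)).
    replace ((x, y) + h)%C with ((u, v) : C) in Hd
      by (unfold h, Cplus; simpl; f_equal; ring).
    eapply Rle_trans; [exact Hd|].
    pose proof (Rmax_l (Rabs (u - x)) (Rabs (v - y))).
    pose proof (Rmax_r (Rabs (u - x)) (Rabs (v - y))). nra. }
  split; intro eps; destruct (K eps) as [dl Hd]; exists dl; intros u v Hu Hv;
    (eapply Rle_trans; [|exact (Hd u v Hu Hv)]).
  - eapply Rle_trans; [|apply im_le_Cmod].
    right. f_equal. unfold Cminus, Cplus, Copp, Cmult, Im, Re; simpl. ring.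
  - eapply Rle_trans; [|apply re_le_Cmod].
    right. f_equal. unfold Cminus, Cplus, Copp, Cmult, Im, Re; simpl. ring.
Qed.

(** With G(s) = g(e^s), the integral of Re G(x + iy) over 0 <= y <= 2 pi does not
    depend on x < log R0.  It is nonnegative at x = 0, and for x near minus
    infinity it is close to 2 pi Re c. *)
Theorem half_plane_principle (g : C -> C) (c : C) (R0 : R) :
  1 < R0 ->
  (forall z, z <> RtoC 0 -> Cmod z < R0 -> cdiff g z) ->
  tends0 g c ->
  (forall z, Cmod z = 1 -> 0 <= Re (g z)) ->
  0 <= Re c.
Proof.
  intros HR Hg Hc Hpos.
  destruct (Rle_lt_dec 0 (Re c)) as [L|L]; [exact L|exfalso].
  pose (G := fun s => g (Cexp s)).
  assert (HX : 0 < ln R0) by (rewrite <- ln_1; apply ln_increasing; lra).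
  assert (Hcl : closed_form (fun u v => Im (G (u, v))) (fun u v => Re (G (u, v))) (ln R0)).
  { intros x y Hx. destruct (Hg (Cexp (x, y)) (Cexp_neq_0 _)) as [d Hd].
    - rewrite Cmod_Cexp. simpl. rewrite <- (exp_ln R0) by lra. now apply exp_increasing.
    - pose proof (cder_comp g Cexp _ _ _ Hd (cder_Cexp (x, y))) as H.
      destruct (cder_closed_form _ _ _ _ H) as [H1 H2].
      do 3 eexists. split; [exact H1|exact H2]. }
  destruct (Hc (- Re c) ltac:(lra)) as (dl & Hdl & Hd).
  (* on the circle of radius e^x1 the values of g are within - Re c of c *)
  set (x1 := ln (Rmin (1 / 2) (dl / 2))).
  assert (Hm : 0 < Rmin (1 / 2) (dl / 2)) by (apply Rmin_pos; lra).
  assert (Hx1 : x1 < 0).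
  { unfold x1. rewrite <- ln_1. apply ln_increasing; trivial.
    eapply Rle_lt_trans; [apply Rmin_l|lra]. }
  assert (Hpi := PI_RGT_0).
  assert (E : RInt (fun y => Re (G (x1, y))) 0 (2 * PI) = RInt (fun y => Re (G (0, y))) 0 (2 * PI)).
  { apply (periodic_integral_constant (fun u v => Im (G (u, v)))
             (fun u v => Re (G (u, v))) (ln R0) (2 * PI) x1 0 Hcl); try lra.
    intros x y. unfold G. do 2 f_equal. unfold Cexp. simpl.
    now rewrite cos_plus, sin_plus, cos_2PI, sin_2PI, !Rmult_0_r, !Rmult_1_r, Rminus_0_r, Rplus_0_r. }
  assert (Hex : forall x, x < ln R0 -> forall a b, ex_RInt (fun y => Re (G (x, y))) a b).
  { intros x Hx a b.
    exact (ex_RInt_vertical (fun u v => Im (G (u, v))) (fun u v => Re (G (u, v))) (ln R0) x a b Hcl Hx). }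
  assert (P0 : 0 <= RInt (fun y => Re (G (0, y))) 0 (2 * PI)).
  { apply RInt_ge_0; [lra|now apply Hex|]. intros y _. apply Hpos.
    rewrite Cmod_Cexp. simpl. apply exp_0. }
  assert (N0 : 0 < RInt (fun y => - Re (G (x1, y))) 0 (2 * PI)).
  { assert (Hcont : forall y, continuous (fun y => Re (G (x1, y))) y).
    { intro y. destruct (Hcl x1 y) as (a & b & d & _ & K); [lra|].
      exact (proj2 (differentiable_pt_lim_continuous _ _ _ _ _ K)). }
    apply RInt_gt_0; [lra| |].
    - intros y _.
      assert (K : Cmod (G (x1, y) - c)%C < - Re c).
      { apply Hd; [apply Cexp_neq_0|]. rewrite Cmod_Cexp. unfold x1; simpl.
        rewrite exp_ln by trivial. eapply Rle_lt_trans; [apply Rmin_r|lra]. }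
      pose proof (re_le_Cmod (G (x1, y) - c)%C) as K2.
      assert (K3 : Re (G (x1, y) - c)%C = Re (G (x1, y)) - Re c)
        by (unfold Cminus; now rewrite re_plus, re_opp).
      rewrite K3 in K2. apply Rabs_le_between in K2. lra.
    - intros y _. apply (continuous_opp (V := R_NormedModule)), Hcont. }
  rewrite (RInt_opp (V := R_CompleteNormedModule)) in N0 by (apply Hex; lra).
  unfold opp in N0; simpl in N0. lra.
Qed.

(** The quotient (g(b + rho z) - g(b)) / (rho z) tends to d at 0 and has modulus
    at most M / rho on the unit circle.  After a rotation that makes d positive,
    the half-plane principle applies to M / rho minus this quotient. *)
Lemma cauchy_estimate (g : C -> C) (b d : C) (rho r M : R) :
  0 < rho < r ->
  (forall z, Cmod (z - b) < r -> cdiff g z) ->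
  (forall z, Cmod (z - b) = rho -> Cmod (g z - g b) <= M) ->
  cder g b d -> Cmod d <= M / rho.
Proof.
  intros [Hrho Hr] Hg HM Hd.
  destruct (exists_rotation d) as (u & Hu & Hud).
  assert (Hrn : RtoC rho <> RtoC 0) by (intro E; apply RtoC_inj in E; lra).
  assert (Hrm : Cmod (RtoC rho) = rho) by (rewrite Cmod_R; apply Rabs_right; lra).
  pose (k := fun z => (RtoC (M / rho) - u * ((g (b + RtoC rho * z) - g b) / (RtoC rho * z)))%C).
  assert (H : 0 <= Re (RtoC (M / rho) - u * d)%C).
  { apply (half_plane_principle k _ (r / rho)).
    - apply (Rmult_lt_reg_r rho); [lra|]. unfold Rdiv. rewrite Rmult_assoc, Rinv_l; lra.
    - intros z Hz Hzr. unfold k.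
      apply cdiff_minus; [apply cdiff_const|]. apply cdiff_mult; [apply cdiff_const|].
      apply cdiff_div; [now apply Cmult_neq_0| |].
      + apply cdiff_minus; [|apply cdiff_const].
        apply (cdiff_comp g (fun z => b + RtoC rho * z)%C).
        * apply Hg. replace (b + RtoC rho * z - b)%C with (RtoC rho * z)%C by ring.
          rewrite Cmod_mult, Hrm.
          apply (Rmult_lt_compat_l rho) in Hzr; [|lra].
          replace (rho * (r / rho)) with r in Hzr by (field; lra). exact Hzr.
        * apply cdiff_plus; [apply cdiff_const|]. apply cdiff_mult; [apply cdiff_const|apply cdiff_id].
      + apply cdiff_mult; [apply cdiff_const|apply cdiff_id].
    - unfold k. apply tends0_minus; [apply tends0_const|].
      apply tends0_mult; [apply tends0_const|].
      apply (tends0_scal (fun z => (g (b + z) - g b) / z)%C); [exact Hrn|].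
      now apply tends0_quotient.
    - intros z Hz. unfold k.
      assert (Hzn : z <> RtoC 0) by (apply Cmod_gt_0; lra).
      set (v := (u * ((g (b + RtoC rho * z) - g b) / (RtoC rho * z)))%C).
      assert (Hv : Cmod v <= M / rho).
      { unfold v. rewrite Cmod_mult, Hu, Rmult_1_l, Cmod_div by (now apply Cmult_neq_0).
        rewrite Cmod_mult, Hz, Hrm, Rmult_1_r. apply Rmult_le_compat_r.
        - left. apply Rinv_0_lt_compat. lra.
        - apply HM. replace (b + RtoC rho * z - b)%C with (RtoC rho * z)%C by ring.
          rewrite Cmod_mult, Hz, Hrm. ring. }
      unfold Cminus. rewrite re_plus, re_opp, re_RtoC.
      pose proof (re_le_Cmod v) as K. apply Rabs_le_between in K. lra. }
  rewrite Hud in H. unfold Cminus in H. rewrite re_plus, re_opp, !re_RtoC in H. lra.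
Qed.

(** * Derivatives of holomorphic functions and Taylor expansions *)

(** Restriction of a complex derivative to the real line, for use with the
    real mean value theorem. *)
Lemma cder_real (k : C -> C) (t : R) (d : C) :
  cder k (RtoC t) d -> is_derive (fun s : R => Re (k (RtoC s))) t (Re d).
Proof.
  intros H. apply is_derive_Reals. intros eps He.
  destruct (proj1 (cder_iff _ _ _) H (eps / 2) ltac:(lra)) as (dl & Hdl & Hd).
  exists (mkposreal dl Hdl). intros h Hh Hhd. simpl in Hhd.
  specialize (Hd (RtoC h)). rewrite Cmod_R in Hd. specialize (Hd Hhd).
  rewrite <- RtoC_plus in Hd.
  pose proof (re_le_Cmod (k (RtoC (t + h)) - k (RtoC t) - d * RtoC h)%C) as K.
  unfold Cminus in K. rewrite !re_plus, !re_opp, re_scal_r in K.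
  fold (Cminus (k (RtoC (t + h))) (k (RtoC t))) in K.
  assert (Hp := Rabs_pos_lt h Hh).
  apply (Rmult_lt_reg_r (Rabs h)); [exact Hp|].
  rewrite <- Rabs_mult.
  replace (((Re (k (RtoC (t + h))) - Re (k (RtoC t))) / h - Re d) * h) with
    (Re (k (RtoC (t + h))) + - Re (k (RtoC t)) + - (Re d * h)) by (field; trivial).
  eapply Rle_lt_trans; [exact K|]. eapply Rle_lt_trans; [exact Hd|]. nra.
Qed.

(** The real mean value theorem along the segment from z to z + h, after a
    rotation that makes the increment of g a positive real number.  The bound is
    required at interior points only: in [tends0_antiderivative] nothing is known at
    the end point 0. *)
Lemma mean_value_bound (g g' : C -> C) (z h : C) (M : R) :
  (forall t, 0 <= t <= 1 -> cder g (z + RtoC t * h)%C (g' (z + RtoC t * h))%C) ->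
  (forall t, 0 < t < 1 -> Cmod (g' (z + RtoC t * h))%C <= M) ->
  Cmod (g (z + h) - g z)%C <= M * Cmod h.
Proof.
  intros H HM. destruct (exists_rotation (g (z + h) - g z)%C) as (u & Hu & Hud).
  pose (k := fun s => (u * g (z + s * h))%C).
  destruct (MVT_cor2 (fun s : R => Re (k (RtoC s)))
    (fun t => Re (u * (h * g' (z + RtoC t * h)))%C) 0 1 Rlt_0_1) as (c & E & Hc).
  - intros t Ht. apply is_derive_Reals. apply cder_real. unfold k. eapply cder_eq.
    + apply cder_mult; [apply cder_const|].
      apply (cder_comp g (fun s => z + s * h)%C); [apply H; exact Ht|].
      apply cder_plus; [apply cder_const|]. apply cder_mult; [apply cder_id|apply cder_const].
    + simpl. ring.
  - unfold k in E.
    replace (z + RtoC 1 * h)%C with (z + h)%C in E by ring.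
    replace (z + RtoC 0 * h)%C with z in E by ring.
    assert (E1 : Re (u * (g (z + h) - g z))%C = Cmod (g (z + h) - g z)%C).
    { rewrite Hud. apply re_RtoC. }
    replace (u * (g (z + h) - g z))%C with (u * g (z + h) + - (u * g z))%C in E1 by ring.
    rewrite re_plus, re_opp in E1.
    assert (Hb : Re (u * (h * g' (z + RtoC c * h)))%C <= M * Cmod h).
    { eapply Rle_trans; [apply Rle_abs|]. eapply Rle_trans; [apply re_le_Cmod|].
      rewrite !Cmod_mult, Hu, Rmult_1_l, Rmult_comm.
      apply Rmult_le_compat_r; [apply Cmod_ge_0|]. now apply HM. }
    lra.
Qed.

(** Everything follows from Cauchy's estimate on discs around a of decreasing
    radius.  As f is bounded near a, f' is bounded, so f is Lipschitz.  The
    estimate for f(w + h) - f(w) then makes f' Lipschitz, so that the difference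
    quotient (f(w + h) - f(w)) / h is within M |h| of f'(w), uniformly in w.
    The estimate for the difference of two such quotients bounds the
    difference of two difference quotients of f' at a by a multiple of
    |h| + |k|, which is a Cauchy condition. *)
Theorem C_derive_cdiff (f : C -> C) (a : C) (r : R) :
  0 < r -> (forall z, Cmod (z - a) < r -> cdiff f z) -> cdiff (C_derive f) a.
Proof.
  intros Hr Hf.
  assert (Df : forall z, Cmod (z - a) < r -> cder f z (C_derive f z)).
  { intros z Hz. now apply cdiff_cder, Hf. }
  destruct (cder_continuous f a _ (Df a ltac:(replace (a - a)%C with (RtoC 0) by ring; rewrite Cmod_0; lra)) 1 Rlt_0_1)
    as (dl & Hdl & Hb).
  (* f varies by at most 2 on the disc of radius 5p; each step below gives up
     a part of this radius *)
  set (p := Rmin dl r / 5).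
  assert (Hm : 0 < Rmin dl r) by now apply Rmin_pos.
  assert (Hp : 0 < p) by (unfold p; lra).
  assert (Hp1 : 5 * p <= dl) by (unfold p; assert (K := Rmin_l dl r); lra).
  assert (Hp2 : 5 * p <= r) by (unfold p; assert (K := Rmin_r dl r); lra).
  clearbody p.
  assert (B5 : forall z w, Cmod (z - a) < 5 * p -> Cmod (w - a) < 5 * p -> Cmod (f z - f w) <= 2).
  { intros z w Hz Hw.
    pose proof (Hb (z - a)%C ltac:(lra)) as K1. pose proof (Hb (w - a)%C ltac:(lra)) as K2.
    replace (a + (z - a))%C with z in K1 by ring. replace (a + (w - a))%C with w in K2 by ring.
    rewrite Cmod_minus_sym in K2.
    replace (f z - f w)%C with ((f z - f a) + (f a - f w))%C by ring.
    eapply Rle_trans; [apply Cmod_triangle|]. lra. }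
  assert (Tri : forall z w, Cmod (w - a) <= Cmod (w - z) + Cmod (z - a)).
  { intros z w. replace (w - a)%C with ((w - z) + (z - a))%C by ring. apply Cmod_triangle. }
  assert (Seg : forall z h t, 0 <= t <= 1 -> Cmod (z + RtoC t * h - z) <= Cmod h).
  { intros z h t Ht. replace (z + RtoC t * h - z)%C with (RtoC t * h)%C by ring.
    rewrite Cmod_mult, Cmod_R, Rabs_right by lra. pose proof (Cmod_ge_0 h). nra. }
  set (M1 := 2 / p).
  assert (HM1 : 0 < M1) by (apply Rdiv_lt_0_compat; lra).
  assert (B4 : forall z, Cmod (z - a) < 4 * p -> Cmod (C_derive f z) <= M1).
  { intros z Hz. apply (cauchy_estimate f z _ p (5 * p - Cmod (z - a)) 2); [lra| | |].
    - intros w Hw. apply Hf. pose proof (Tri z w). lra.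
    - intros w Hw. apply B5; [|lra]. pose proof (Tri z w). lra.
    - apply Df. lra. }
  assert (L3 : forall z h, Cmod (z - a) < 3 * p -> Cmod h < p ->
    Cmod (f (z + h) - f z)%C <= M1 * Cmod h).
  { intros z h Hz Hh. 
    assert (S : forall t, 0 <= t <= 1 -> Cmod (z + RtoC t * h - a) < 4 * p).
    { intros t Ht. pose proof (Tri z (z + RtoC t * h)%C). pose proof (Seg z h t Ht). lra. }
    apply (mean_value_bound f (C_derive f)); intros t Ht.
    - apply Df. specialize (S t Ht). lra.
    - apply B4, S. lra. }
  assert (Dsh : forall h z, Cmod (z + h - a) < r ->
    cder (fun w => f (w + h)%C) z (C_derive f (z + h)%C)).
  { intros h z Hz. eapply cder_eq.
    - apply (cder_comp f (fun w => w + h)%C); [now apply Df|].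
      apply cder_plus; [apply cder_id|apply cder_const].
    - ring. }
  assert (Tri2 : forall z h, Cmod (z + h - a) <= Cmod (z - a) + Cmod h).
  { intros z h. replace (z + h - a)%C with ((z - a) + h)%C by ring. apply Cmod_triangle. }
  set (M2 := 4 * M1 / p).
  assert (HM2 : 0 < M2) by (apply Rdiv_lt_0_compat; lra).
  assert (L2 : forall z h, Cmod (z - a) < 2 * p -> Cmod h < p ->
    Cmod (C_derive f (z + h) - C_derive f z)%C <= M2 * Cmod h).
  { intros z h Hz Hh.
    replace (M2 * Cmod h) with (2 * M1 * Cmod h / (p / 2)) by (unfold M2; field; lra).
    apply (cauchy_estimate (fun w => f (w + h) - f w)%C z _ (p / 2) p); [lra| | |].
    - intros w Hw. pose proof (Tri z w). pose proof (Tri2 w h).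
      eexists. apply cder_minus; [apply Dsh; lra|apply Df; lra].
    - intros w Hw. pose proof (Tri z w).
      unfold Cminus at 1. eapply Rle_trans; [apply Cmod_triangle|]. rewrite Cmod_opp.
      pose proof (L3 z h ltac:(lra) Hh). pose proof (L3 w h ltac:(lra) Hh). lra.
    - pose proof (Tri2 z h). apply cder_minus; [apply Dsh; lra|apply Df; lra]. }
  assert (Q : forall z h, Cmod (z - a) < p -> h <> RtoC 0 -> Cmod h < p ->
    Cmod ((f (z + h) - f z) / h - C_derive f z)%C <= M2 * Cmod h).
  { intros z h Hz Hn Hh. assert (Hm0 := proj1 (Cmod_gt_0 h) Hn).
    pose (k := fun w => (f w - C_derive f z * w)%C).
    assert (K : Cmod (k (z + h)%C - k z) <= M2 * Cmod h * Cmod h).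
    { apply (mean_value_bound k (fun w => C_derive f w - C_derive f z)%C).
      - intros t Ht. pose proof (Seg z h t Ht). pose proof (Tri z (z + RtoC t * h)%C).
        eapply cder_eq; [apply cder_minus; [apply Df; lra|]|].
        + apply cder_mult; [apply cder_const|apply cder_id].
        + cbv beta; ring.
      - intros t Ht. pose proof (Seg z h t ltac:(lra)) as S.
        replace (z + RtoC t * h - z)%C with (RtoC t * h)%C in S by ring.
        eapply Rle_trans; [apply L2; lra|]. apply Rmult_le_compat_l; lra. }
    replace (k (z + h)%C - k z)%C with (((f (z + h) - f z) / h - C_derive f z) * h)%C in K
      by (unfold k; field; trivial).
    rewrite Cmod_mult in K. apply Rmult_le_reg_r in K; trivial. }
  destruct (lipschitz_at_0_limit
    (fun h => (C_derive f (a + h) - C_derive f a) / h)%C p (4 * M2 / p)) as [L HL].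
  - exact Hp.
  - apply Rlt_le, Rdiv_lt_0_compat; lra.
  - intros h k Hh Hk Hhp Hkp.
    replace (4 * M2 / p * (Cmod h + Cmod k)) with
      (2 * (M2 * (Cmod h + Cmod k)) / (p / 2)) by (field; lra).
    set (K := fun w => ((f (w + h) - f w) / h - (f (w + k) - f w) / k)%C).
    assert (HK : forall z, Cmod (z - a) < p -> Cmod (K z) <= M2 * (Cmod h + Cmod k)).
    { intros z Hz. unfold K.
      replace ((f (z + h) - f z) / h - (f (z + k) - f z) / k)%C with
        (((f (z + h) - f z) / h - C_derive f z) + - ((f (z + k) - f z) / k - C_derive f z))%C by ring.
      eapply Rle_trans; [apply Cmod_triangle|]. rewrite Cmod_opp.
      pose proof (Q z h Hz Hh Hhp). pose proof (Q z k Hz Hk Hkp). lra. }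
    assert (Haa : Cmod (a - a) = 0) by (replace (a - a)%C with (RtoC 0) by ring; apply Cmod_0).
    assert (DK : forall z, Cmod (z - a) < p -> cder K z
      ((C_derive f (z + h) - C_derive f z) / h - (C_derive f (z + k) - C_derive f z) / k)%C).
    { intros z Hz. pose proof (Tri2 z h). pose proof (Tri2 z k). eapply cder_eq.
      - apply cder_minus; (apply cder_mult; [apply cder_minus; [apply Dsh; lra|apply Df; lra]|apply cder_const]).
      - simpl. unfold Cdiv. ring. }
    apply (cauchy_estimate K a _ (p / 2) p); [lra| | |].
    + intros z Hz. eexists. now apply DK.
    + intros z Hz. unfold Cminus at 1. eapply Rle_trans; [apply Cmod_triangle|]. rewrite Cmod_opp.
      pose proof (HK z ltac:(lra)). pose proof (HK a ltac:(lra)). lra.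
    + apply DK. lra.
  - exists L. now apply tends0_cder.
Qed.

Lemma disc_refine (z : C) (r : R) : Cmod z < r ->
  forall w, Cmod (w - z) < r - Cmod z -> Cmod w < r.
Proof.
  intros Hz w Hw. replace w with ((w - z) + z)%C by ring.
  eapply Rle_lt_trans; [apply Cmod_triangle|]. lra.
Qed.

Lemma holomorphic_C_derive (f : C -> C) (r : R) :
  (forall z, Cmod z < r -> cdiff f z) -> forall z, Cmod z < r -> cdiff (C_derive f) z.
Proof.
  intros H z Hz. apply (C_derive_cdiff f z (r - Cmod z)); [lra|].
  intros w Hw. apply H. now apply (disc_refine z).
Qed.

(** A form of l'Hospital's rule: subtract from k the monomial that accounts for c; the
    derivative of the rest is o(z^n), and integrating along the segment
    from 0 to z gains one power of z. *)
Lemma tends0_antiderivative (k k' : C -> C) (n : nat) (c : C) (r : R) :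
  0 < r -> (forall z, Cmod z < r -> cder k z (k' z)) -> k (RtoC 0) = RtoC 0 ->
  tends0 (fun z => k' z / z ^ n)%C c ->
  tends0 (fun z => k z / z ^ S n)%C (c / RtoC (INR (S n)))%C.
Proof.
  intros Hr Hk Hk0 Hc eps He.
  destruct (Hc (eps / 2) ltac:(lra)) as (dl & Hdl & Hd).
  exists (Rmin dl r). split; [now apply Rmin_pos|]. intros z Hz Hzd.
  destruct (Rmin_Rgt_l _ _ _ Hzd) as [Z1 Z2].
  assert (Hm := proj1 (Cmod_gt_0 z) Hz).
  assert (HN : RtoC (INR (S n)) <> RtoC 0).
  { intro E. apply RtoC_inj in E. revert E. apply not_0_INR. lia. }
  assert (Hzn : (z ^ S n)%C <> RtoC 0) by now apply Cpow_nz.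
  assert (T : forall t, 0 <= t <= 1 -> Cmod (0 + RtoC t * z) <= Cmod z).
  { intros t Ht. rewrite Cplus_0_l, Cmod_mult, Cmod_R, Rabs_right by lra. nra. }
  pose (m := fun w => (k w - c / RtoC (INR (S n)) * w ^ S n)%C).
  assert (K : Cmod (m (0 + z)%C - m (RtoC 0)) <= eps / 2 * Cmod z ^ n * Cmod z).
  { apply (mean_value_bound m (fun w => k' w - c * w ^ n)%C); intros t Ht.
    - eapply cder_eq.
      + apply cder_minus; [apply Hk; specialize (T t Ht); lra|].
        apply cder_mult; [apply cder_const|apply cder_pow].
      + cbv beta. field. exact HN.
    - specialize (T t ltac:(lra)). set (w := (0 + RtoC t * z)%C) in *.
      assert (Hw : w <> RtoC 0).
      { unfold w. rewrite Cplus_0_l. apply Cmult_neq_0; trivial.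
        intro E. apply RtoC_inj in E. lra. }
      assert (Hwn : (w ^ n)%C <> RtoC 0) by now apply Cpow_nz.
      specialize (Hd w Hw ltac:(lra)).
      replace (k' w - c * w ^ n)%C with ((k' w / w ^ n - c) * w ^ n)%C by (field; trivial).
      rewrite Cmod_mult, Cmod_pow. apply Rmult_le_compat; try lra.
      + apply Cmod_ge_0.
      + apply pow_le, Cmod_ge_0.
      + apply pow_incr. split; [apply Cmod_ge_0|exact T]. }
  rewrite Cplus_0_l in K. unfold m in K. rewrite Hk0 in K.
  replace (0 - c / RtoC (INR (S n)) * 0 ^ S n)%C with (RtoC 0) in K by (rewrite Cpow_S; ring).
  replace (k z / z ^ S n - c / RtoC (INR (S n)))%C with
    ((k z - c / RtoC (INR (S n)) * z ^ S n - 0) / z ^ S n)%C by (field; auto).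
  rewrite Cmod_div, Cmod_pow by trivial.
  assert (Hp : 0 < Cmod z ^ S n) by now apply pow_lt.
  apply (Rmult_lt_reg_r (Cmod z ^ S n)); [exact Hp|]. unfold Rdiv at 1.
  rewrite Rmult_assoc, Rinv_l by lra. simpl in *. nra.
Qed.

Lemma taylor_order_2 (g g1 : C -> C) (b : C) (r : R) :
  0 < r -> (forall z, Cmod z < r -> cder g z (g1 z)) -> cder g1 (RtoC 0) b ->
  tends0 (fun z => (g z - g (RtoC 0) - g1 (RtoC 0) * z) / z ^ 2)%C (b / 2)%C.
Proof.
  intros Hr Hg Hb.
  eapply tends0_eq.
  - apply (tends0_antiderivative (fun z => g z - g (RtoC 0) - g1 (RtoC 0) * z)%C
      (fun z => g1 z - g1 (RtoC 0))%C 1 b r Hr).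
    + intros z Hz. eapply cder_eq.
      * apply cder_minus; [apply cder_minus; [now apply Hg|apply cder_const]|].
        apply cder_mult; [apply cder_const|apply cder_id].
      * cbv beta. ring.
    + ring.
    + eapply tends0_ext; [apply tends0_quotient, Hb|]. exists 1. split; [lra|].
      intros z _ _. now rewrite Cplus_0_l, Cpow_1_r.
  - reflexivity.
Qed.

Lemma taylor_order_3 (g g1 g2 : C -> C) (b : C) (r : R) :
  0 < r -> (forall z, Cmod z < r -> cder g z (g1 z)) ->
  (forall z, Cmod z < r -> cder g1 z (g2 z)) -> cder g2 (RtoC 0) b ->
  tends0 (fun z => (g z - g (RtoC 0) - g1 (RtoC 0) * z - g2 (RtoC 0) / 2 * z ^ 2) / z ^ 3)%C (b / 6)%C.
Proof.
  intros Hr Hg Hg1 Hb.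
  eapply tends0_eq.
  - apply (tends0_antiderivative
      (fun z => g z - g (RtoC 0) - g1 (RtoC 0) * z - g2 (RtoC 0) / 2 * z ^ 2)%C
      (fun z => g1 z - g1 (RtoC 0) - g2 (RtoC 0) * z)%C 2 (b / 2)%C r Hr).
    + intros z Hz. eapply cder_eq.
      * apply cder_minus; [apply cder_minus; [apply cder_minus; [now apply Hg|apply cder_const]|]|].
        -- apply cder_mult; [apply cder_const|apply cder_id].
        -- apply cder_mult; [apply cder_const|apply (cder_pow 1)].
      * cbv beta. replace (INR 2) with 2 by (simpl; ring). field.
    + ring.
    + exact (taylor_order_2 g1 g2 b r Hr Hg1 Hb).
  - replace (INR 3) with 3 by (simpl; ring).
    replace 6 with (2 * 3) by ring. rewrite RtoC_mult.
    field.
Qed.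

(** The factor E extends (exp z - 1 - z) / z^2 continuously to 0, so that the
    expansion can be composed with a function that may vanish away from 0. *)
Lemma Cexp_second_order :
  exists E : C -> C, (forall z, Cexp z = 1 + z + E z * z ^ 2)%C /\
    E (RtoC 0) = (1 / 2)%C /\ tends0 E (1 / 2)%C.
Proof.
  pose (E := fun z => if Ceq_dec z (RtoC 0) then (1 / 2)%C else ((Cexp z - 1 - z) / z ^ 2)%C).
  exists E. split; [|split].
  - intro z. unfold E. destruct (Ceq_dec z (RtoC 0)) as [->|N].
    + rewrite Cexp_0. ring.
    + field. trivial.
  - unfold E. destruct (Ceq_dec (RtoC 0) (RtoC 0)) as [_|N]; [reflexivity|now destruct N].
  - eapply tends0_eq; [eapply tends0_ext|].
    + apply (taylor_order_2 Cexp Cexp (RtoC 1) 1 Rlt_0_1 (fun z _ => cder_Cexp z)).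
      exact (cder_eq _ _ _ _ (cder_Cexp _) Cexp_0).
    + exists 1. split; [lra|]. intros z Hz _. unfold E.
      destruct (Ceq_dec z (RtoC 0)) as [E0|_]; [now destruct Hz|].
      rewrite Cexp_0. f_equal. ring.
    + reflexivity.
Qed.

(** Convergence at one point r/2 bounds the coefficients geometrically; the
    remainder after two terms is then dominated by a geometric series of order
    |w|^3. *)
Lemma series_order_2 (a : nat -> C) (s : C -> C) (r : R) :
  0 < r ->
  (forall w, Cmod w < r ->
     @is_series C_AbsRing C_NormedModule (fun n => a (S n) * w ^ S n)%C (s w)) ->
  tends0 (fun w => (s w - a 1%nat * w) / w ^ 2)%C (a 2%nat).
Proof.
  intros Hr Hs.
  set (w0 := r / 2). assert (Hw0 : 0 < w0) by (unfold w0; lra).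
  assert (Mw0 : Cmod (RtoC w0) = w0) by (rewrite Cmod_R; apply Rabs_right; lra).
  assert (exists B, 0 <= B /\ forall n, Cmod (a (S n)) * w0 ^ S n <= B) as (B & HB0 & HB).
  { destruct (filterlim_bounded (V := C_NormedModule)
      (sum_n (G := C_NormedModule) (fun n => a (S n) * RtoC w0 ^ S n)%C)) as [M HM].
    - exists (s (RtoC w0)). apply Hs. rewrite Mw0. unfold w0. lra.
    - assert (HM' : forall n, Cmod (sum_n (G := C_NormedModule) (fun n => a (S n) * RtoC w0 ^ S n)%C n) <= M)
        by exact HM.
      exists (2 * M). pose proof (Cmod_ge_0 (sum_n (G := C_NormedModule) (fun n => a (S n) * RtoC w0 ^ S n)%C 0)).
      pose proof (HM' 0%nat). split; [lra|].
      intros [|n]; rewrite <- Mw0, <- Cmod_pow, <- Cmod_mult.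
      + rewrite sum_O in *. lra.
      + pose proof (HM' (S n)) as K1. pose proof (HM' n) as K2.
        rewrite sum_Sn in K1.
        set (S1 := sum_n (G := C_NormedModule) (fun n => a (S n) * RtoC w0 ^ S n)%C n) in *.
        set (t := (a (S (S n)) * RtoC w0 ^ S (S n))%C) in *.
        change (Cmod (S1 + t)%C <= M) in K1.
        replace t with ((S1 + t) - S1)%C by ring.
        unfold Cminus. eapply Rle_trans; [apply Cmod_triangle|]. rewrite Cmod_opp. lra. }
  intros eps He.
  set (K := 2 * B / w0 ^ 3).
  assert (Hw3 : 0 < w0 ^ 3) by now apply pow_lt.
  assert (HK : 0 <= K).
  { unfold K. apply Rmult_le_pos; [lra|]. left. now apply Rinv_0_lt_compat. }
  exists (Rmin (w0 / 2) (eps / (K + 1))). split.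
  { apply Rmin_pos; [lra|]. apply Rdiv_lt_0_compat; lra. }
  intros w Hw Hwd. destruct (Rmin_Rgt_l _ _ _ Hwd) as [W1 W2].
  assert (Hm := proj1 (Cmod_gt_0 w) Hw).
  set (q := Cmod w / w0).
  assert (Hq0 : 0 < q) by (apply Rdiv_lt_0_compat; lra).
  assert (Hq : q <= / 2).
  { unfold q. apply (Rmult_le_reg_r w0); [lra|]. unfold Rdiv. rewrite Rmult_assoc, Rinv_l by lra. lra. }
  assert (Eq : Cmod w = w0 * q) by (unfold q; field; lra).
  assert (Tm : forall n, Cmod (a (S n) * w ^ S n)%C <= B * q ^ S n).
  { intro n. rewrite Cmod_mult, Cmod_pow, Eq, Rpow_mult_distr, <- Rmult_assoc.
    apply Rmult_le_compat_r; [apply pow_le; lra|apply HB]. }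
  set (S0 := (a 1%nat * w + a 2%nat * w ^ 2)%C).
  (* the term q^(n+3) leaves room for the induction, as q <= 1/2 *)
  assert (Part : forall n, Cmod (sum_n (G := C_NormedModule) (fun n => a (S n) * w ^ S n)%C (S n) - S0)
     <= 2 * B * (q ^ 3 - q ^ (n + 3))).
  { induction n as [|n IH].
    - rewrite sum_Sn, sum_O. unfold S0.
      change (plus (a 1%nat * w ^ 1) (a 2%nat * w ^ 2))%C with (a 1%nat * w ^ 1 + a 2%nat * w ^ 2)%C.
      replace (a 1%nat * w ^ 1 + a 2%nat * w ^ 2 - (a 1%nat * w + a 2%nat * w ^ 2))%C with (RtoC 0) by ring.
      rewrite Cmod_0. simpl. lra.
    - rewrite sum_Sn.
      set (S1 := sum_n (G := C_NormedModule) (fun n => a (S n) * w ^ S n)%C (S n)) in *.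
      set (t := (a (S (S (S n))) * w ^ S (S (S n)))%C).
      change (Cmod (S1 + t - S0)%C <= 2 * B * (q ^ 3 - q ^ (S n + 3))).
      replace (S1 + t - S0)%C with ((S1 - S0) + t)%C by ring.
      eapply Rle_trans; [apply Cmod_triangle|].
      assert (Cmod t <= B * q ^ (n + 3)).
      { replace (n + 3)%nat with (S (S (S n))) by lia. apply Tm. }
      replace (S n + 3)%nat with (S (n + 3)) by lia.
      assert (0 < q ^ (n + 3)) by now apply pow_lt.
      assert (B * q ^ (n + 3) * q <= B * q ^ (n + 3) * / 2).
      { apply Rmult_le_compat_l; [|exact Hq]. apply Rmult_le_pos; lra. }
      simpl (q ^ S (n + 3)). nra. }
  assert (Lim : Cmod (s w - S0) <= 2 * B * q ^ 3).
  { apply le_epsilon. intros e Hepos.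
    assert (He2 : 0 < e / 2) by lra.
    assert (Hw_r : Cmod w < r) by (unfold w0 in *; lra).
    destruct (Hs w Hw_r (fun v => ball (M := C_UniformSpace) (s w) (mkposreal _ He2) v)) as [N HN].
    { exists (mkposreal _ He2). trivial. }
    specialize (HN (S N) ltac:(lia)). cbv beta in HN.
    apply C_NormedModule_mixin_compat2 in HN.
    specialize (Part N).
    set (S1 := sum_n (G := C_NormedModule) (fun n => a (S n) * w ^ S n)%C (S N)) in *.
    change (Cmod (S1 - s w) < sqrt 2 * (e / 2)) in HN.
    pose proof sqrt_2_le_2 as S2.
    replace (s w - S0)%C with ((S1 - S0) + - (S1 - s w))%C by ring.
    eapply Rle_trans; [apply Cmod_triangle|]. rewrite Cmod_opp.
    assert (0 < q ^ (N + 3)) by now apply pow_lt. nra. }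
  replace ((s w - a 1%nat * w) / w ^ 2 - a 2%nat)%C with ((s w - S0) / w ^ 2)%C
    by (unfold S0; field; trivial).
  rewrite Cmod_div, Cmod_pow by (now apply Cpow_nz).
  assert (Hm2 : 0 < Cmod w ^ 2) by now apply pow_lt.
  apply (Rmult_lt_reg_r (Cmod w ^ 2)); [exact Hm2|]. unfold Rdiv at 1.
  rewrite Rmult_assoc, Rinv_l, Rmult_1_r by lra.
  eapply Rle_lt_trans; [exact Lim|].
  replace (2 * B * q ^ 3) with (K * Cmod w * Cmod w ^ 2) by (unfold K; rewrite Eq; field; lra).
  apply Rmult_lt_compat_r; [exact Hm2|].
  apply (Rmult_lt_compat_r (K + 1)) in W2; [|lra].
  unfold Rdiv in W2. rewrite Rmult_assoc, Rinv_l in W2 by lra. nra.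
Qed.

(** * Caratheodory's inequality *)

(** Let q(z) = 1 + x z + m z^2.  On |z| = 1 the conjugate of z is 1/z, so |q|^2
    is a Laurent polynomial and p |q|^2 a function with a pole at 0.  The singular
    part of this function is a combination of 1/z and 1/z^2; replacing it by its
    conjugate on the circle, a polynomial in z, keeps the real part on the
    circle and removes the pole.  The value at 0 of the resulting function g is
    the complex number in the conclusion. *)
Lemma toeplitz_positivity (p : C -> C) (c1 c2 x m : C) (R0 : R) :
  1 < R0 ->
  (forall z, z <> RtoC 0 -> Cmod z < R0 -> cdiff p z) ->
  tends0 (fun z => (p z - 1 - c1 * z) / z ^ 2)%C c2 ->
  (forall z, Cmod z = 1 -> 0 <= Re (p z)) ->
  0 <= Re (1 + x * Cconj x + m * Cconj m + c1 * (Cconj x + Cconj m * x) + c2 * Cconj m)%C.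
Proof.
  intros HR Hp Hc Hpos.
  set (x' := Cconj x). set (m' := Cconj m). set (c1' := Cconj c1).
  (* k0, k1, m and the conjugates k1', m' of k1, m are the Laurent coefficients
     of |q|^2.  In g, p is written as 1 + c1 z + z^2 P, and the last summand
     replaces the singular part. *)
  pose (P := fun z => ((p z - 1 - c1 * z) / z ^ 2)%C).
  pose (k0 := (1 + x * x' + m * m')%C).
  pose (k1 := (x + m * x')%C). pose (k1' := (x' + m' * x)%C).
  pose (g := fun z => (k0 + k1 * z + m * z * z
     + c1 * (k0 * z + k1 * z * z + m * z * z * z + k1')
     + P z * (k0 * z * z + k1 * z * z * z + m * z * z * z * z + k1' * z + m')
     + ((k1 + m * c1') * z + m * z * z))%C).
  apply (half_plane_principle g _ R0 HR).
  - intros z Hz HzR. unfold g, P.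
    assert (HP : cdiff (fun z => ((p z - 1 - c1 * z) / z ^ 2)%C) z).
    { apply cdiff_div; [now apply Cpow_nz| |].
      - apply cdiff_minus; [apply cdiff_minus; [now apply Hp|apply cdiff_const]|].
        apply cdiff_mult; [apply cdiff_const|apply cdiff_id].
      - eexists. apply (cder_pow 1). }
    cdiff_rules.
  - unfold g. eapply tends0_eq.
    + assert (HP : tends0 (fun z => P z) c2) by exact Hc. tends0_rules.
    + unfold k0, k1'. ring.
  - intros z Hz.
    assert (Hzn : z <> RtoC 0) by (apply Cmod_gt_0; lra).
    assert (Hzc : Cconj z = (/ z)%C).
    { pose proof (Cmult_conj_unit z Hz) as H.
      replace (Cconj z) with (/ z * (z * Cconj z))%C by (field; trivial). rewrite H. ring. }
    pose (q := (1 + x * z + m * z * z)%C).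
    pose (W := ((k1 + m * c1') * z + m * z * z)%C).
    assert (E : g z = (p z * RtoC (Cmod q ^ 2) + (W - Cconj W))%C).
    { rewrite Cmod2_conj. unfold g, W, q, P, k1, k0, k1'.
      rewrite !Cplus_conj, !Cmult_conj. rewrite Hzc.
      unfold c1', x', m'. rewrite !Cplus_conj, !Cmult_conj, !Cconj_conj.
      replace (Cconj (RtoC 1)) with (RtoC 1) by (unfold Cconj, RtoC; simpl; f_equal; ring).
      field. exact Hzn. }
    rewrite E. unfold Cminus. rewrite !re_plus, re_opp, re_conj, re_scal_r.
    pose proof (Hpos z Hz). pose proof (pow2_ge_0 (Cmod q)). nra.
Qed.

(** Let D = c2 - c1^2/2.  In [toeplitz_positivity] take m of modulus 1 with
    conj(m) D = - |D|, and for x the value - (c1 + m conj(c1)) / 2 that minimizes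
    the form; the result is 2 - |c1|^2/2 - |D| >= 0. *)
Lemma caratheodory_on_unit_circle (p : C -> C) (c1 c2 : C) (R0 : R) :
  1 < R0 ->
  (forall z, z <> RtoC 0 -> Cmod z < R0 -> cdiff p z) ->
  tends0 (fun z => (p z - 1 - c1 * z) / z ^ 2)%C c2 ->
  (forall z, Cmod z = 1 -> 0 <= Re (p z)) ->
  Cmod (c2 - c1 ^ 2 / 2)%C + Cmod c1 ^ 2 / 2 <= 2.
Proof.
  intros HR Hp Hc Hpos.
  set (D := (c2 - c1 ^ 2 / 2)%C).
  destruct (exists_rotation D) as (u & Hu & HuD).
  pose (m := (- Cconj u)%C).
  assert (Em : Cconj m = (- u)%C) by (unfold m; now rewrite Copp_conj, Cconj_conj).
  assert (Un : u <> RtoC 0) by (apply Cmod_gt_0; lra).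
  assert (Hcu : Cconj u = (/ u)%C).
  { pose proof (Cmult_conj_unit u Hu) as H.
    replace (Cconj u) with (/ u * (u * Cconj u))%C by (field; trivial). rewrite H. ring. }
  pose (x := (- (c1 + m * Cconj c1) / 2)%C).
  assert (Ex : Cconj x = (- (Cconj c1 - u * c1) / 2)%C).
  { unfold x, Cdiv. rewrite Cmult_conj, Copp_conj, Cplus_conj, Cmult_conj, Em, Cconj_conj.
    rewrite <- RtoC_inv by lra.
    replace (Cconj (RtoC (/ 2))) with (RtoC (/ 2)) by (unfold Cconj, RtoC; simpl; f_equal; ring).
    ring. }
  pose proof (toeplitz_positivity p c1 c2 x m R0 HR Hp Hc Hpos) as H.
  rewrite Ex, Em in H.
  (* V - conj V is the part of the form that disappears on taking real parts *)
  pose (V := (u * c1 * c1 / 4)%C).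
  assert (EV : Cconj V = (/ u * Cconj c1 * Cconj c1 / 4)%C).
  { unfold V, Cdiv. rewrite !Cmult_conj, Hcu. rewrite <- RtoC_inv by lra.
    do 2 f_equal. unfold Cconj, RtoC; simpl; f_equal; ring. }
  match type of H with 0 <= Re ?e =>
    replace e with (RtoC 2 - (c1 * Cconj c1) * RtoC (/ 2) + - (u * D) + (V - Cconj V))%C in H end.
  - rewrite HuD, <- Cmod2_conj in H. unfold Cminus in H.
    rewrite !re_plus, !re_opp, re_conj, re_scal_r, !re_RtoC in H. lra.
  - rewrite EV. unfold V, D, x, m. rewrite Hcu, RtoC_inv by lra. field. exact Un.
Qed.

(** Apply the previous inequality to p(r z), which is differentiable beyond the
    unit circle, and let r tend to 1. *)
Theorem caratheodory_second_coefficient (p : C -> C) (c1 c2 : C) :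
  (forall z, z <> RtoC 0 -> Cmod z < 1 -> cdiff p z) ->
  tends0 (fun z => (p z - 1 - c1 * z) / z ^ 2)%C c2 ->
  (forall z, z <> RtoC 0 -> Cmod z < 1 -> 0 <= Re (p z)) ->
  Cmod (c2 - c1 ^ 2 / 2)%C + Cmod c1 ^ 2 / 2 <= 2.
Proof.
  intros Hp Hc Hpos.
  set (S := Cmod (c2 - c1 ^ 2 / 2)%C + Cmod c1 ^ 2 / 2).
  assert (H : forall r, 0 < r < 1 -> r ^ 2 * S <= 2).
  { intros r Hr.
    assert (Hrn : RtoC r <> RtoC 0) by (intro E; apply RtoC_inj in E; lra).
    assert (Hrm : Cmod (RtoC r) = r) by (rewrite Cmod_R; apply Rabs_right; lra).
    assert (K : Cmod (c2 * RtoC r ^ 2 - (c1 * RtoC r) ^ 2 / 2)%C + Cmod (c1 * RtoC r) ^ 2 / 2 <= 2).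
    { apply (caratheodory_on_unit_circle (fun z => p (RtoC r * z)%C) _ _ (/ r)).
      - rewrite <- Rinv_1. apply Rinv_lt_contravar; lra.
      - intros z Hz Hzr. apply (cdiff_comp p (fun z => RtoC r * z)%C).
        + apply Hp; [now apply Cmult_neq_0|]. rewrite Cmod_mult, Hrm.
          apply (Rmult_lt_compat_l r) in Hzr; [|lra]. rewrite Rinv_r in Hzr; lra.
        + apply cdiff_mult; [apply cdiff_const|apply cdiff_id].
      - eapply tends0_ext.
        + apply (tends0_mult _ _ _ _
            (tends0_scal _ _ _ Hrn Hc) (tends0_const (RtoC r ^ 2)%C)).
        + exists 1. split; [lra|]. intros z Hz _. cbv beta. field. split; trivial.
      - intros z Hz. apply Hpos; [|rewrite Cmod_mult, Hrm, Hz; lra].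
        apply Cmult_neq_0; trivial. apply Cmod_gt_0. lra. }
    replace (c2 * RtoC r ^ 2 - (c1 * RtoC r) ^ 2 / 2)%C with ((c2 - c1 ^ 2 / 2) * RtoC r ^ 2)%C in K by field.
    rewrite !Cmod_mult, Cmod_pow, Hrm in K. unfold S. nra. }
  assert (HS : 0 <= S).
  { unfold S. pose proof (Cmod_ge_0 (c2 - c1 ^ 2 / 2)). pose proof (pow2_ge_0 (Cmod c1)). lra. }
  destruct (Rle_lt_dec S 2) as [L|L]; [exact L|exfalso].
  (* r = 1 - d with r^2 S >= (1 - 2d) S = S/2 + 1 > 2 *)
  pose (d := (S - 2) / (4 * S)).
  assert (Hd : 0 < d < 1).
  { unfold d. split; [apply Rdiv_lt_0_compat; lra|].
    apply (Rmult_lt_reg_r (4 * S)); [lra|]. unfold Rdiv. rewrite Rmult_assoc, Rinv_l; lra. }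
  assert (Ed : d * (4 * S) = S - 2) by (unfold d; field; lra).
  specialize (H (1 - d) ltac:(lra)). nra.
Qed.

(** * Coefficients of f, of its inverse, and the bound *)

Lemma class_A_expansion (f : C -> C) :
  class_A f -> exists a2 a3,
    tends0 (fun z => (f z - z - a2 * z ^ 2) / z ^ 3)%C a3 /\
    tends0 (fun z => (C_derive f z - 1 - 2 * a2 * z) / z ^ 2)%C (3 * a3)%C.
Proof.
  intros (Hhol & H0 & H1).
  assert (D0 : forall z, Cmod z < 1 -> cdiff f z) by exact Hhol.
  pose proof (holomorphic_C_derive f 1 D0) as D1.
  pose proof (holomorphic_C_derive _ 1 D1) as D2.
  assert (L0 : Cmod (RtoC 0) < 1) by (rewrite Cmod_0; lra).
  set (f1 := C_derive f) in *. set (f2 := C_derive f1) in *.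
  pose proof (cdiff_cder _ _ (D2 _ L0)) as E3.
  set (b := C_derive f2 (RtoC 0)) in *.
  exists (f2 (RtoC 0) / 2)%C, (b / 6)%C. split.
  - pose proof (taylor_order_3 f f1 f2 b 1 Rlt_0_1
      (fun z Hz => cdiff_cder f z (D0 z Hz)) (fun z Hz => cdiff_cder f1 z (D1 z Hz)) E3) as T.
    rewrite H0, H1 in T. eapply tends0_ext; [exact T|]. exists 1. split; [lra|].
    intros z Hz _. cbv beta. f_equal. ring.
  - pose proof (taylor_order_2 f1 f2 b 1 Rlt_0_1
      (fun z Hz => cdiff_cder f1 z (D1 z Hz)) E3) as T.
    rewrite H1 in T. eapply tends0_eq; [eapply tends0_ext; [exact T|]|].
    + exists 1. split; [lra|]. intros z Hz _. cbv beta. f_equal. field.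
    + field.
Qed.

(** Caratheodory's inequality for p(z) = 2 z f'(z) / (f(z) - f(-z)).  Only odd
    powers survive in f(z) - f(-z) = 2z + 2 a3 z^3 + ..., so that
    p(z) = 1 + 2 a2 z + 2 a3 z^2 + ... *)
Lemma starlike_second_coefficient (f : C -> C) (a2 a3 : C) :
  starlike_symmetric f ->
  tends0 (fun z => (f z - z - a2 * z ^ 2) / z ^ 3)%C a3 ->
  tends0 (fun z => (C_derive f z - 1 - 2 * a2 * z) / z ^ 2)%C (3 * a3)%C ->
  Cmod (2 * a3 - (2 * a2) ^ 2 / 2)%C + Cmod (2 * a2)%C ^ 2 / 2 <= 2.
Proof.
  intros [(Hhol & H0 & H1) Hst] HA HB.
  assert (D0 : forall z, Cmod z < 1 -> cdiff f z) by exact Hhol.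
  pose (p := fun z => (2 * z * C_derive f z / (f z - f (- z)))%C).
  apply (caratheodory_second_coefficient p).
  - intros z Hz Hz1. destruct (Hst z Hz1 Hz) as [Hne _].
    assert (cdiff f z) by now apply D0.
    assert (cdiff (C_derive f) z) by now apply (holomorphic_C_derive f 1).
    assert (cdiff (fun z => f (- z)%C) z).
    { apply (cdiff_comp f Copp); [apply D0; now rewrite Cmod_opp|].
      apply (cdiff_opp (fun z => z)), cdiff_id. }
    unfold p. apply cdiff_div; [now apply Cminus_eq_contra| |]; cdiff_rules.
  - pose (A := fun z => ((f z - z - a2 * z ^ 2) / z ^ 3)%C).
    pose (B := fun z => ((C_derive f z - 1 - 2 * a2 * z) / z ^ 2)%C).
    assert (TA : tends0 (fun z => A z) a3) by exact HA.
    assert (TB : tends0 (fun z => B z) (3 * a3)%C) by exact HB.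
    assert (TA' : tends0 (fun z => A (- z)%C) a3).
    { eapply tends0_ext; [apply (tends0_scal A a3 (- RtoC 1)%C)|].
      - intro E. apply (f_equal (fun z => (- z)%C)) in E.
        replace (- - RtoC 1)%C with (RtoC 1) in E by ring.
        replace (- RtoC 0)%C with (RtoC 0) in E by ring. now apply C1_nz.
      - exact TA.
      - exists 1. split; [lra|]. intros z _ _. f_equal. ring. }
    (* f(z) - f(-z) = z (2 + z^2 (A(z) + A(-z))) and f' = 1 + 2 a2 z + z^2 B *)
    eapply tends0_eq; [eapply tends0_ext|].
    + apply (tends0_div
        (fun z => 2 * B z - (1 + 2 * a2 * z) * (A z + A (- z)))%C
        (fun z => 2 + z * z * (A z + A (- z)))%C).
      2: now tends0_rules. 2: now tends0_rules.
      intro E. replace (RtoC 2 + 0 * 0 * (a3 + a3))%C with (RtoC 2) in E by ring.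
      apply RtoC_inj in E. lra.
    + exists 1. split; [lra|]. intros z Hz Hz1.
      destruct (Hst z Hz1 Hz) as [Hne _]. apply Cminus_eq_contra in Hne.
      assert (E1 : (f z - f (- z))%C = (z * (2 + z * z * (A z + A (- z))))%C).
      { unfold A. field. trivial. }
      assert (E2 : C_derive f z = (1 + 2 * a2 * z + z ^ 2 * B z)%C).
      { unfold B. field. trivial. }
      rewrite E1 in Hne.
      assert (Hn2 : (2 + z * z * (A z + A (- z)))%C <> RtoC 0).
      { intro E. apply Hne. rewrite E. ring. }
      unfold p. rewrite E1, E2. field. split; trivial.
    + field.
  - intros z Hz Hz1. destruct (Hst z Hz1 Hz) as [_ Hpos].
    unfold p. replace (2 * z * C_derive f z / (f z - f (- z)))%C with
      (RtoC 2 * (z * C_derive f z / (f z - f (- z))))%C by (unfold Cdiv; ring).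
    rewrite re_scal_l. lra.
Qed.

(** F(w) / w = exp(L(w)) with L(w) = 2 Gamma_1 w + 2 Gamma_2 w^2 + ..., expanded
    by exp(L) = 1 + L + L^2/2 + ... *)
Lemma log_coefficients_expansion (F : C -> C) (Gamma : nat -> C) :
  log_coefficients F Gamma ->
  (exists r, 0 < r /\ forall w, w <> RtoC 0 -> Cmod w < r -> F w <> RtoC 0) /\
  tends0 (fun w => (F w / w - 1 - 2 * Gamma 1%nat * w) / w ^ 2)%C
    (2 * Gamma 2%nat + 2 * Gamma 1%nat ^ 2)%C.
Proof.
  intros (r & L & Hr & [_ Hbr] & Hser).
  assert (Hexp : forall w, w <> RtoC 0 -> Cmod w < r -> Cexp (L w) = (F w / w)%C).
  { intros w Hw Hwr. now apply (Hbr w Hwr). }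
  split.
  { exists r. split; trivial. intros w Hw Hwr E. apply (Cexp_neq_0 (L w)).
    rewrite Hexp, E by trivial. unfold Cdiv. ring. }
  set (G1 := Gamma 1%nat). set (G2 := Gamma 2%nat).
  assert (HL : tends0 (fun w => (L w - 2 * G1 * w) / w ^ 2)%C (2 * G2)%C).
  { eapply tends0_ext.
    - apply tends0_mult; [apply (tends0_const (RtoC 2))|].
      apply (series_order_2 Gamma (fun w => L w / 2)%C r Hr).
      intros w Hw. destruct (Hser w Hw) as (s & Hs & ->).
      replace (2 * s / 2)%C with s by field. exact Hs.
    - exists 1. split; [lra|]. intros w Hw _. cbv beta. fold G1. field. trivial. }
  set (l2 := fun w => ((L w - 2 * G1 * w) / w ^ 2)%C) in HL.
  assert (HL2 : tends0 (fun w => l2 w) (2 * G2)%C) by exact HL.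
  assert (L0 : tends0 L (RtoC 0)).
  { apply (tends0_of_quotient L (RtoC 0) (2 * G1)%C (2 * G2)%C 1).
    eapply tends0_ext; [exact HL|]. exists 1. split; [lra|]. intros w Hw _.
    unfold l2. f_equal. ring. }
  destruct Cexp_second_order as (E & HE & E0 & TE).
  pose proof (tends0_subst_extended E L _ E0 TE L0) as TEL.
  eapply tends0_eq; [eapply tends0_ext|].
  - apply (tends0_plus (fun w => l2 w) (fun w => E (L w) * ((2 * G1 + w * l2 w) * (2 * G1 + w * l2 w)))%C);
      [exact HL|]. tends0_rules.
  - exists r. split; trivial. intros w Hw Hwr. rewrite <- (Hexp w Hw Hwr), HE.
    replace (2 * G1 + w * l2 w)%C with (L w / w)%C by (unfold l2; field; trivial).
    unfold l2. field. trivial.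
  - field.
Qed.

(** With F(w) = w + A2 w^2 + A3 w^3 + ..., comparing coefficients in f(F(w)) = w
    gives A2 = - a2 and A3 = 2 a2^2 - a3. *)
Lemma inverse_log_coefficients_eq (f : C -> C) (Gamma : nat -> C) (a2 a3 : C) :
  tends0 (fun z => (f z - z - a2 * z ^ 2) / z ^ 3)%C a3 ->
  inverse_log_coefficients f Gamma ->
  Gamma 1%nat = (- a2 / 2)%C /\ Gamma 2%nat = (- (a3 - 3 / 2 * a2 ^ 2) / 2)%C.
Proof.
  intros HA (F & [(r & Hr & _ & Hinv) _] & Hlog).
  destruct (log_coefficients_expansion F Gamma Hlog) as [(r1 & Hr1 & HF0) Hpsi].
  set (A2 := (2 * Gamma 1%nat)%C) in *.
  set (A3 := (2 * Gamma 2%nat + 2 * Gamma 1%nat ^ 2)%C) in *.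
  pose (phi := fun w => (F w / w)%C).
  pose (psi := fun w => ((F w / w - 1 - A2 * w) / w ^ 2)%C).
  pose (A := fun z => ((f z - z - a2 * z ^ 2) / z ^ 3)%C).
  assert (Tpsi : tends0 (fun w => psi w) A3) by exact Hpsi.
  assert (Tphi : tends0 (fun w => phi w) (RtoC 1)) by exact (tends0_of_quotient phi _ A2 A3 1 Hpsi).
  assert (TF : tends0 F (RtoC 0)).
  { eapply tends0_eq; [eapply tends0_ext; [apply (tends0_mult _ _ _ _ tends0_id Tphi)|]|].
    - exists 1. split; [lra|]. intros w Hw _. unfold phi. field. trivial.
    - ring. }
  assert (TAF : tends0 (fun w => A (F w)) a3).
  { apply (tends0_subst A F a3 r1 Hr1 HF0 TF). exact HA. }
  assert (Main : forall w, w <> RtoC 0 -> Cmod w < Rmin r r1 ->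
    (RtoC 1 = phi w + a2 * w * phi w ^ 2 + w ^ 2 * phi w ^ 3 * A (F w))%C).
  { intros w Hw Hwr. destruct (Rmin_Rgt_l _ _ _ Hwr) as [W1 W2].
    destruct (Hinv w W1) as [_ E]. pose proof (HF0 w Hw W2) as HFn.
    unfold phi, A. rewrite E. field. split; trivial. }
  (* Dividing the equation Main by w, then by w^2, and passing to the limit
     yields the two coefficient identities E2 and E3. *)
  assert (Hrm : 0 < Rmin r r1) by now apply Rmin_pos.
  assert (Ephi : forall w, w <> RtoC 0 -> phi w = (1 + A2 * w + w ^ 2 * psi w)%C).
  { intros w Hw. unfold phi, psi. field. trivial. }
  assert (E2 : (A2 + a2)%C = RtoC 0).
  { apply (tends0_unique (fun w => A2 + w * psi w + a2 * (phi w * phi w)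
                            + w * (phi w * phi w * phi w) * A (F w))%C).
    - eapply tends0_eq; [tends0_rules|]. ring.
    - eapply tends0_ext; [apply tends0_const|]. exists (Rmin r r1). split; trivial.
      intros w Hw Hwr. pose proof (Main w Hw Hwr) as M.
      assert (K : (w * (A2 + w * psi w + a2 * (phi w * phi w)
                  + w * (phi w * phi w * phi w) * A (F w)) = 0)%C).
      { transitivity (phi w + a2 * w * phi w ^ 2 + w ^ 2 * phi w ^ 3 * A (F w) - 1)%C.
        - rewrite (Ephi w Hw). ring.
        - rewrite <- M. ring. }
      destruct (Ceq_dec (A2 + w * psi w + a2 * (phi w * phi w)
                  + w * (phi w * phi w * phi w) * A (F w))%C (RtoC 0)) as [Z|N]; [now rewrite Z|].
      exfalso. exact (Cmult_neq_0 _ _ Hw N K). }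
  assert (Ea2 : a2 = (- A2)%C).
  { replace a2 with ((A2 + a2) - A2)%C by ring. rewrite E2. ring. }
  assert (E3 : (A3 - A2 * (2 * A2) + a3)%C = RtoC 0).
  { apply (tends0_unique (fun w => psi w - A2 * ((A2 + w * psi w) * (phi w + 1))
                            + (phi w * phi w * phi w) * A (F w))%C).
    - eapply tends0_eq; [tends0_rules|]. ring.
    - eapply tends0_ext; [apply tends0_const|]. exists (Rmin r r1). split; trivial.
      intros w Hw Hwr. pose proof (Main w Hw Hwr) as M. rewrite Ea2 in M.
      set (X := (psi w - A2 * ((A2 + w * psi w) * (phi w + 1))
                  + (phi w * phi w * phi w) * A (F w))%C).
      assert (K : (w * w * X = 0)%C).
      { transitivity (phi w + - A2 * w * phi w ^ 2 + w ^ 2 * phi w ^ 3 * A (F w) - 1)%C.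
        - unfold X. rewrite (Ephi w Hw). ring.
        - rewrite <- M. ring. }
      destruct (Ceq_dec X (RtoC 0)) as [Z|N]; [now rewrite Z|].
      exfalso. exact (Cmult_neq_0 _ _ (Cmult_neq_0 _ _ Hw Hw) N K). }
  assert (Ea3 : a3 = (A2 * (2 * A2) - A3)%C).
  { replace a3 with ((A3 - A2 * (2 * A2) + a3) + (A2 * (2 * A2) - A3))%C by ring. rewrite E3. ring. }
  rewrite Ea2, Ea3. unfold A2, A3. split; field.
Qed.

(** With t = |c1|^2 and y = |c2 - 3/4 c1^2| <= 2 - t/4, the bound is
    t + y^2 <= 4 + t^2/16 <= 5 for 0 <= t <= 4. *)
Theorem toeplitz_determinant_bound (f : C -> C) (Gamma : nat -> C) :
  starlike_symmetric f -> inverse_log_coefficients f Gamma ->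
  Cmod (T21 Gamma) <= 5 / 16.
Proof.
  intros Hf HG.
  destruct (class_A_expansion f (proj1 Hf)) as (a2 & a3 & HA & HB).
  pose proof (starlike_second_coefficient f a2 a3 Hf HA HB) as K.
  destruct (inverse_log_coefficients_eq f Gamma a2 a3 HA HG) as [E1 E2].
  unfold T21. rewrite E1, E2.
  set (c1 := (2 * a2)%C) in *. set (Dv := (2 * a3 - c1 ^ 2 / 2)%C) in *.
  replace ((- a2 / 2) ^ 2 - (- (a3 - 3 / 2 * a2 ^ 2) / 2) ^ 2)%C with
    ((c1 ^ 2 - (Dv - c1 ^ 2 / 4) ^ 2) * RtoC (/ 16))%C
    by (unfold Dv, c1; rewrite RtoC_inv by lra; field).
  rewrite Cmod_mult, Cmod_R, (Rabs_right (/ 16)) by lra.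
  assert (X : Cmod (c1 ^ 2 - (Dv - c1 ^ 2 / 4) ^ 2)%C <= Cmod c1 ^ 2 + Cmod (Dv - c1 ^ 2 / 4) ^ 2).
  { unfold Cminus at 1. eapply Rle_trans; [apply Cmod_triangle|].
    rewrite Cmod_opp, !Cmod_pow. lra. }
  assert (Y : Cmod (Dv - c1 ^ 2 / 4)%C <= Cmod Dv + Cmod c1 ^ 2 / 4).
  { unfold Cminus at 1. eapply Rle_trans; [apply Cmod_triangle|].
    rewrite Cmod_opp, Cmod_div, Cmod_pow, Cmod_R, (Rabs_right 4); [lra|lra|].
    intro E. apply RtoC_inj in E. lra. }
  pose proof (Cmod_ge_0 (Dv - c1 ^ 2 / 4)). pose proof (Cmod_ge_0 Dv).
  pose proof (pow2_ge_0 (Cmod c1)).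
  set (t := Cmod c1 ^ 2) in *. set (y := Cmod (Dv - c1 ^ 2 / 4)%C) in *.
  assert (y <= 2 - t / 4) by lra. assert (t <= 4) by lra.
  assert (y ^ 2 <= (2 - t / 4) ^ 2) by (apply pow_incr; lra). nra.
Qed.

(** * The extremal function *)

Lemma one_minus_neq_0 (v : C) : Cmod v < 1 -> (1 - v)%C <> RtoC 0.
Proof.
  intros Hv E. assert (v = RtoC 1) as ->.
  { replace v with (1 - (1 - v))%C by ring. rewrite E. ring. }
  rewrite Cmod_1 in Hv. lra.
Qed.

Lemma Cmod_Ci_mult (z : C) : Cmod (Ci * z) = Cmod z.
Proof. rewrite Cmod_mult, Cmod_Ci. ring. Qed.

Lemma one_minus_iz_neq_0 (z : C) : Cmod z < 1 -> (1 - Ci * z)%C <> RtoC 0.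
Proof. intro H. apply one_minus_neq_0. now rewrite Cmod_Ci_mult. Qed.

Lemma one_plus_iz_neq_0 (z : C) : Cmod z < 1 -> (1 + Ci * z)%C <> RtoC 0.
Proof.
  intro H. replace (1 + Ci * z)%C with (1 - Ci * - z)%C by ring.
  apply one_minus_iz_neq_0. now rewrite Cmod_opp.
Qed.

Lemma cder_h5 (z : C) : Cmod z < 1 -> cder h5 z (1 / (1 - Ci * z) ^ 2)%C.
Proof.
  intro Hz. pose proof (one_minus_iz_neq_0 z Hz) as N. unfold h5. eapply cder_eq.
  - apply cder_div; [exact N|apply cder_id|].
    apply cder_minus; [apply cder_const|]. apply cder_mult; [apply cder_const|apply cder_id].
  - cbv beta. field. exact N.
Qed.

(** Re ((1 + v) / (1 - v)) = (1 - |v|^2) / |1 - v|^2. *)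
Lemma cayley_positive (v : C) : Cmod v < 1 -> 0 < Re ((1 + v) / (1 - v))%C.
Proof.
  intro Hv. pose proof (one_minus_neq_0 v Hv) as N.
  assert (Hm := proj1 (Cmod_gt_0 _) N).
  assert (H : (Re ((1 + v) / (1 - v)) * Cmod (1 - v) ^ 2 = 1 - Cmod v ^ 2)%R).
  { rewrite <- re_scal_r, Cmod2_conj.
    replace ((1 + v) / (1 - v) * ((1 - v) * Cconj (1 - v)))%C with
      ((1 + v) * Cconj (1 - v))%C by (field; exact N).
    rewrite (Cmod2_alt v). destruct v as [a b].
    unfold Cconj, Cminus, Cplus, Copp, Cmult, RtoC, Re, Im; simpl. ring. }
  assert (Cmod v ^ 2 < 1).
  { pose proof (Cmod_ge_0 v). nra. }
  assert (0 < Cmod (1 - v) ^ 2) by now apply pow_lt.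
  apply (Rmult_lt_reg_r (Cmod (1 - v) ^ 2)); [trivial|]. lra.
Qed.

Lemma h5_starlike : starlike_symmetric h5.
Proof.
  split; [split; [|split]|].
  - intros z Hz. eexists. now apply cder_h5.
  - unfold h5. field.
  - apply is_C_derive_unique. eapply cder_eq; [apply cder_h5; rewrite Cmod_0; lra|].
    replace (1 - Ci * 0)%C with (RtoC 1) by ring. field.
  - intros z Hz Hz0. unfold Defs.disc in Hz.
    pose proof (one_minus_iz_neq_0 z Hz) as N1. pose proof (one_plus_iz_neq_0 z Hz) as N2.
    assert (E : (h5 z - h5 (- z) = 2 * z / ((1 - Ci * z) * (1 + Ci * z)))%C).
    { unfold h5. replace (1 - Ci * - z)%C with (1 + Ci * z)%C by ring.
      field_simplify_eq; [|split; trivial]. ring. }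
    assert (T : RtoC 2 <> RtoC 0) by (intro H; apply RtoC_inj in H; lra).
    split.
    + intro Eq. rewrite Eq in E. 
      assert (K : (2 * z = 0)%C).
      { transitivity ((2 * z / ((1 - Ci * z) * (1 + Ci * z))) * ((1 - Ci * z) * (1 + Ci * z)))%C.
        - field. split; trivial.
        - rewrite <- E. ring. }
      exact (Cmult_neq_0 _ _ T Hz0 K).
    + rewrite E, (is_C_derive_unique _ _ _ (cder_h5 z Hz)).
      replace (z * (1 / (1 - Ci * z) ^ 2) / (2 * z / ((1 - Ci * z) * (1 + Ci * z))))%C with
        (RtoC (/ 2) * ((1 + Ci * z) / (1 - Ci * z)))%C
        by (rewrite RtoC_inv by lra; field; repeat split; trivial).
      rewrite re_scal_l. apply Rmult_lt_0_compat; [lra|].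
      apply cayley_positive. now rewrite Cmod_Ci_mult.
Qed.

Definition h5_inverse (w : C) : C := (w / (1 + Ci * w))%C.

Lemma h5_local_inverse : local_inverse h5 h5_inverse.
Proof.
  split.
  - exists (1 / 2). split; [lra|]. split.
    + intros w Hw. unfold Defs.disc in Hw.
      assert (N := one_plus_iz_neq_0 w ltac:(lra)).
      unfold h5_inverse. eexists. apply cder_div; [exact N|apply cder_id|].
      apply cder_plus; [apply cder_const|]. apply cder_mult; [apply cder_const|apply cder_id].
    + intros w Hw. unfold Defs.disc in *.
      assert (N := one_plus_iz_neq_0 w ltac:(lra)).
      unfold h5, h5_inverse. split.
      * rewrite Cmod_div by trivial.
        pose proof (Cmod_triangle_inv 1 (- (Ci * w))) as T.
        rewrite Cmod_1, Cmod_opp, Cmod_Ci_mult in T.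
        replace (1 - - (Ci * w))%C with (1 + Ci * w)%C in T by ring.
        apply (Rmult_lt_reg_r (Cmod (1 + Ci * w))); [lra|].
        unfold Rdiv. rewrite Rmult_assoc, Rinv_l by lra. lra.
      * replace (1 - Ci * (w / (1 + Ci * w)))%C with (/ (1 + Ci * w))%C by (field; trivial).
        field. trivial.
  - exists 1. split; [lra|]. intros z Hz. unfold Defs.disc in Hz.
    assert (N := one_minus_iz_neq_0 z Hz).
    unfold h5, h5_inverse.
    replace (1 + Ci * (z / (1 - Ci * z)))%C with (/ (1 - Ci * z))%C by (field; trivial).
    field. trivial.
Qed.

(** The principal branch of - log (1 + i w), where 1 + i w = (1 - Im w) + i Re w
    lies in the right half-plane. *)
Definition log_quotient (w : C) : C :=
  (- (/ 2 * ln ((1 - Im w) ^ 2 + Re w ^ 2)), - atan (Re w / (1 - Im w))).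

Lemma Im_lt_1 (w : C) : Cmod w < 1 -> 0 < 1 - Im w.
Proof. intro H. pose proof (im_le_Cmod w) as K. apply Rabs_le_between in K. lra. Qed.

Lemma log_quotient_0 : log_quotient (RtoC 0) = RtoC 0.
Proof.
  unfold log_quotient, RtoC, Re, Im; simpl.
  replace ((1 - 0) * ((1 - 0) * 1) + 0 * (0 * 1)) with 1 by ring.
  replace (0 / (1 - 0)) with 0 by field. rewrite ln_1, atan_0. f_equal; ring.
Qed.

Lemma Cexp_log_quotient (w : C) : Cmod w < 1 -> Cexp (log_quotient w) = (/ (1 + Ci * w))%C.
Proof.
  intro Hw. pose proof (Im_lt_1 w Hw) as Hd. pose proof (one_plus_iz_neq_0 w Hw) as N.
  destruct w as [x y]. simpl in Hd.
  set (d := 1 - y) in *. set (t := x / d).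
  assert (Hs : 0 < 1 + t * t) by nra.
  assert (Hss : 0 < sqrt (1 + t * t)) by now apply sqrt_lt_R0.
  assert (Hs2 : sqrt (1 + t * t) * sqrt (1 + t * t) = 1 + t * t) by (apply sqrt_sqrt; lra).
  set (s := sqrt (1 + t * t)) in *.
  assert (EN : d ^ 2 + x ^ 2 = (d * s) ^ 2).
  { replace ((d * s) ^ 2) with (d ^ 2 * (s * s)) by ring. rewrite Hs2. unfold t. field. lra. }
  assert (Hexp : exp (- (/ 2 * ln (d ^ 2 + x ^ 2))) = / (d * s)).
  { rewrite EN, ln_pow by (apply Rmult_lt_0_compat; lra).
    replace (/ 2 * (INR 2 * ln (d * s))) with (ln (d * s)) by (simpl; field).
    rewrite exp_Ropp, exp_ln; trivial. apply Rmult_lt_0_compat; lra. }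
  unfold log_quotient, Cexp, Re, Im. cbn [fst snd].
  fold d. fold t. rewrite Hexp, cos_neg, sin_neg, cos_atan, sin_atan.
  unfold Rsqr. fold s.
  assert (ED : (1 + Ci * (x, y) = ((d, x) : C))%C).
  { unfold d, Ci, Cplus, Cmult, RtoC; simpl. f_equal; ring. }
  rewrite ED in *. unfold Cinv; simpl.
  replace (d * (d * 1) + x * (x * 1)) with ((d * s) ^ 2) by (rewrite <- EN; ring).
  assert (Ex : x = t * d) by (unfold t; field; lra).
  f_equal.
  - field. lra.
  - rewrite Ex at 1. field. lra.
Qed.

Lemma continuous_log_quotient (w : C) : Cmod w < 1 ->
  @continuous C_UniformSpace C_UniformSpace log_quotient w.
Proof.
  intro Hw. pose proof (Im_lt_1 w Hw) as Hd.
  assert (CR : @continuous C_UniformSpace R_UniformSpace Re w) by apply (continuous_fst (U := R_UniformSpace) (V := R_UniformSpace)).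
  assert (CI : @continuous C_UniformSpace R_UniformSpace Im w) by apply (continuous_snd (U := R_UniformSpace) (V := R_UniformSpace)).
  assert (C1 : @continuous C_UniformSpace R_UniformSpace (fun w => 1 - Im w) w).
  { apply (continuous_minus (V := R_NormedModule)); [apply continuous_const|exact CI]. }
  assert (CN : @continuous C_UniformSpace R_UniformSpace (fun w => (1 - Im w) ^ 2 + Re w ^ 2) w).
  { apply (continuous_plus (V := R_NormedModule)).
    - simpl. apply (continuous_mult (K := R_AbsRing)); [exact C1|].
      apply (continuous_mult (K := R_AbsRing)); [exact C1|apply continuous_const].
    - simpl. apply (continuous_mult (K := R_AbsRing)); [exact CR|].
      apply (continuous_mult (K := R_AbsRing)); [exact CR|apply continuous_const]. }
  apply (continuous_comp_2 (U := C_UniformSpace) (V := R_UniformSpace) (W := R_UniformSpace) (X := C_UniformSpace)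
     (fun w => - (/ 2 * ln ((1 - Im w) ^ 2 + Re w ^ 2)))
     (fun w => - atan (Re w / (1 - Im w))) (fun a b => (a, b) : C)).
  - apply (continuous_opp (V := R_NormedModule)).
    apply (continuous_scal_r (V := R_NormedModule) (/ 2)).
    apply (continuous_comp (V := R_UniformSpace) (fun w => (1 - Im w) ^ 2 + Re w ^ 2) ln); [exact CN|].
    apply continuity_pt_filterlim, derivable_continuous_pt.
    exists (/ ((1 - Im w) ^ 2 + Re w ^ 2)). apply derivable_pt_lim_ln.
    pose proof (pow2_ge_0 (Re w)). assert (0 < (1 - Im w) ^ 2) by now apply pow_lt. lra.
  - apply (continuous_opp (V := R_NormedModule)).
    apply (continuous_comp (V := R_UniformSpace) (fun w => Re w / (1 - Im w)) atan).
    + apply (continuous_mult (K := R_AbsRing)); [exact CR|].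
      apply (continuous_comp (V := R_UniformSpace) (fun w => 1 - Im w) Rinv); [exact C1|].
      apply continuous_Rinv. lra.
    + apply continuity_pt_filterlim, derivable_continuous_pt, derivable_pt_atan.
  - apply (continuous_ext (U := C_UniformSpace) (fun p => p)); [now intros []|apply continuous_id].
Qed.

(** Any continuous logarithm of a differentiable function v is differentiable.
    With D = L(w + h) - L(w), which tends to 0, the expansion
    v(w + h) / v(w) = exp(D) = 1 + D (1 + o(1)) can be solved for D / h. *)
Lemma continuous_logarithm_cder (L v : C -> C) (w d : C) :
  @continuous C_UniformSpace C_UniformSpace L w ->
  (exists r, 0 < r /\ forall h, Cmod h < r -> Cexp (L (w + h)%C) = v (w + h)%C) ->
  cder v w d -> cder L w (d / v w)%C.
Proof.
  intros HL (r & Hr & HE) Hv. apply tends0_cder.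
  pose (D := fun h => (L (w + h) - L w)%C).
  assert (TD : tends0 (fun h => D h) (RtoC 0)).
  { intros eps He.
    assert (He2 : 0 < eps / 2) by lra.
    destruct (HL (fun u => ball (M := C_UniformSpace) (L w) (mkposreal _ He2) u)) as [dl Hdl].
    { exists (mkposreal _ He2). trivial. }
    exists dl. split; [apply cond_pos|]. intros h Hh Hhd.
    assert (B : ball (M := C_UniformSpace) (L w) (mkposreal _ He2) (L (w + h)%C)).
    { apply Hdl. apply (C_NormedModule_mixin_compat1 w (w + h)%C dl).
      change (Cmod (w + h - w) < dl). now replace (w + h - w)%C with h by ring. }
    apply C_NormedModule_mixin_compat2 in B.
    change (Cmod (L (w + h) - L w)%C < sqrt 2 * (eps / 2)) in B.
    pose proof sqrt_2_le_2 as S2.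
    replace (D h - 0)%C with (L (w + h) - L w)%C by (unfold D; ring). nra. }
  assert (Hv0 : v w <> RtoC 0).
  { pose proof (HE (RtoC 0) ltac:(rewrite Cmod_0; lra)) as E. rewrite Cplus_0_r in E.
    rewrite <- E. apply Cexp_neq_0. }
  destruct Cexp_second_order as (E & HE2 & E0 & TE).
  pose proof (tends0_subst_extended E (fun h => D h) _ E0 TE TD) as TED.
  pose proof (tends0_quotient v w d Hv) as Tv.
  assert (N1 : (RtoC 1 + 0 * (1 / 2))%C <> RtoC 0).
  { replace (RtoC 1 + 0 * (1 / 2))%C with (RtoC 1) by ring. apply C1_nz. }
  assert (T1 : tends0 (fun h => 1 + D h * E (D h))%C (RtoC 1 + 0 * (1 / 2))%C) by tends0_rules.
  (* the denominator stays away from 0 near 0 *)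
  assert (HN : exists r', 0 < r' /\ forall h, h <> RtoC 0 -> Cmod h < r' ->
    (1 + D h * E (D h))%C <> RtoC 0).
  { destruct (T1 1 Rlt_0_1) as (dl & Hdl & Hd). exists dl. split; trivial.
    intros h Hh Hhd Z. specialize (Hd h Hh Hhd). rewrite Z in Hd.
    replace (0 - (1 + 0 * (1 / 2)))%C with (- RtoC 1)%C in Hd by ring.
    rewrite Cmod_opp, Cmod_1 in Hd. lra. }
  destruct HN as (r' & Hr' & HN).
  eapply tends0_eq; [eapply tends0_ext|].
  - apply (tends0_div (fun h => (v (w + h) - v w) / h / v w)%C
      (fun h => 1 + D h * E (D h))%C (d / v w)%C _ N1); [|exact T1].
    apply (tends0_mult (fun h => (v (w + h) - v w) / h)%C (fun _ => / v w)%C); [exact Tv|apply tends0_const].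
  - exists (Rmin r r'). split; [now apply Rmin_pos|]. intros h Hh Hhd.
    destruct (Rmin_Rgt_l _ _ _ Hhd) as [H1 H2]. specialize (HN h Hh H2).
    assert (EV : v (w + h)%C = (v w * (1 + D h * (1 + D h * E (D h))))%C).
    { rewrite <- (HE h H1).
      pose proof (HE (RtoC 0) ltac:(rewrite Cmod_0; lra)) as E1. rewrite Cplus_0_r in E1.
      rewrite <- E1. replace (L (w + h)%C) with (L w + D h)%C by (unfold D; ring).
      rewrite Cexp_plus, (HE2 (D h)). ring. }
    change (L (w + h) - L w)%C with (D h). rewrite EV. field. repeat split; trivial.
  - field. trivial.
Qed.

Lemma cder_log_quotient (w : C) : Cmod w < 1 ->
  cder log_quotient w (- Ci / (1 + Ci * w))%C.
Proof.
  intro Hw. pose proof (one_plus_iz_neq_0 w Hw) as N. eapply cder_eq.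
  - apply (continuous_logarithm_cder log_quotient (fun w => / (1 + Ci * w))%C).
    + now apply continuous_log_quotient.
    + exists (1 - Cmod w). split; [lra|]. intros h Hh. apply Cexp_log_quotient.
      eapply Rle_lt_trans; [apply Cmod_triangle|lra].
    + apply cder_inv; [exact N|]. apply cder_plus; [apply cder_const|].
      apply cder_mult; [apply cder_const|apply cder_id].
  - cbv beta. field. exact N.
Qed.

Definition h5_Gamma (n : nat) : C := ((- Ci) ^ n / (2 * RtoC (INR n)))%C.

(** The derivative of the n-th partial sum is a finite geometric sum, so it
    differs from the derivative of half of [log_quotient] by a multiple of
    w^(n+1) / (1 + iw); integrating along the segment from 0 to w bounds the
    remainder. *)
Lemma log_quotient_series (w : C) : Cmod w < 1 ->
  @is_series C_AbsRing C_NormedModule (fun n => h5_Gamma (S n) * w ^ S n)%C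
    (log_quotient w / 2)%C.
Proof.
  intro Hw.
  pose (S_ := fun n w => sum_n (G := C_NormedModule) (fun n => h5_Gamma (S n) * w ^ S n)%C n).
  assert (T2 : RtoC 2 <> RtoC 0) by (intro E; apply RtoC_inj in E; lra).
  assert (DS : forall n v, Cmod v < 1 ->
    cder (S_ n) v (- Ci / 2 * (1 - (- Ci * v) ^ S n) / (1 + Ci * v))%C).
  { intros n v Hv. pose proof (one_plus_iz_neq_0 v Hv) as N.
    assert (Dt : forall m, cder (fun w => h5_Gamma (S m) * w ^ S m)%C v (- Ci / 2 * (- Ci * v) ^ m)%C).
    { intro m. eapply cder_eq.
      - apply cder_mult; [apply cder_const|apply cder_pow].
      - unfold h5_Gamma. rewrite Cpow_mult_l, (Cpow_S (- Ci)).
        assert (RtoC (INR (S m)) <> RtoC 0).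
        { intro E. apply RtoC_inj in E. revert E. apply not_0_INR. lia. }
        field. trivial. }
    induction n as [|n IH].
    - apply (is_derive_ext (V := C_NormedModule) (fun w => h5_Gamma 1 * w ^ 1)%C).
      + intro t. unfold S_. now rewrite sum_O.
      + eapply cder_eq; [apply (Dt 0%nat)|]. field. exact N.
    - apply (is_derive_ext (V := C_NormedModule) (fun w => S_ n w + h5_Gamma (S (S n)) * w ^ S (S n))%C).
      + intro t. unfold S_. now rewrite sum_Sn.
      + eapply cder_eq; [apply cder_plus; [exact IH|apply (Dt (S n))]|].
        rewrite !Cpow_S. field. exact N. }
  set (q := Cmod w) in *. assert (Hq : 0 <= q) by apply Cmod_ge_0.
  assert (Rem : forall n, Cmod (log_quotient w / 2 - S_ n w) <= q ^ S n / (1 - q)).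
  { intro n.
    pose (k := fun v => (log_quotient v / 2 - S_ n v)%C).
    assert (K0 : k (RtoC 0) = RtoC 0).
    { unfold k. rewrite log_quotient_0.
      assert (E : S_ n (RtoC 0) = RtoC 0).
      { unfold S_. clear. induction n as [|n IH].
        - rewrite sum_O, Cpow_S.
          change (h5_Gamma 1 * (RtoC 0 * RtoC 0 ^ 0) = RtoC 0)%C. ring.
        - rewrite sum_Sn, IH, Cpow_S.
          change (RtoC 0 + h5_Gamma (S (S n)) * (RtoC 0 * RtoC 0 ^ S n) = RtoC 0)%C. ring. }
      rewrite E. field. }
    assert (T : forall t, 0 <= t <= 1 -> Cmod (0 + RtoC t * w) <= q).
    { intros t Ht. rewrite Cplus_0_l, Cmod_mult, Cmod_R, Rabs_right by lra. fold q. nra. }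
    assert (M : Cmod (k (0 + w)%C - k (RtoC 0)) <= q ^ S n / (1 - q) * Cmod w).
    { apply (mean_value_bound k (fun v => - Ci / 2 * (- Ci * v) ^ S n / (1 + Ci * v))%C); intros t Ht.
      - specialize (T t Ht). set (v := (0 + RtoC t * w)%C) in *.
        pose proof (one_plus_iz_neq_0 v ltac:(lra)) as N.
        unfold k. eapply cder_eq.
        + apply cder_minus; [|apply DS; lra].
          apply cder_mult; [apply cder_log_quotient; lra|apply cder_const].
        + cbv beta. set (X := ((- Ci * v) ^ S n)%C). field. exact N.
      - specialize (T t ltac:(lra)). set (v := (0 + RtoC t * w)%C) in *.
        pose proof (one_plus_iz_neq_0 v ltac:(lra)) as N.
        assert (Dn : 1 - q <= Cmod (1 + Ci * v)).
        { pose proof (Cmod_triangle_inv 1 (- (Ci * v))) as I.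
          rewrite Cmod_1, Cmod_opp, Cmod_Ci_mult in I.
          replace (1 - - (Ci * v))%C with (1 + Ci * v)%C in I by ring. lra. }
        assert (E : Cmod (- Ci / 2 * (- Ci * v) ^ S n / (1 + Ci * v))
                    = / 2 * (Cmod v ^ S n * / Cmod (1 + Ci * v))).
        { rewrite Cmod_div, Cmod_mult, Cmod_div, Cmod_pow, Cmod_mult, !Cmod_opp, Cmod_Ci, Cmod_R,
            (Rabs_right 2) by (trivial; lra). rewrite Rmult_1_l. field. lra. }
        rewrite E. unfold Rdiv.
        assert (Pv : Cmod v ^ S n <= q ^ S n) by (apply pow_incr; split; [apply Cmod_ge_0|trivial]).
        assert (P0 : 0 <= Cmod v ^ S n) by (apply pow_le, Cmod_ge_0).
        assert (I1 : / Cmod (1 + Ci * v) <= / (1 - q)) by (apply Rinv_le_contravar; lra).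
        assert (I0 : 0 < / Cmod (1 + Ci * v)) by (apply Rinv_0_lt_compat; lra).
        assert (Cmod v ^ S n * / Cmod (1 + Ci * v) <= q ^ S n * / (1 - q))
          by (apply Rmult_le_compat; lra).
        assert (0 <= Cmod v ^ S n * / Cmod (1 + Ci * v)) by (apply Rmult_le_pos; lra).
        lra. }
    rewrite K0, Cplus_0_l in M. unfold k in M. fold q in M.
    replace (log_quotient w / 2 - S_ n w - 0)%C with (log_quotient w / 2 - S_ n w)%C in M by ring.
    assert (0 <= q ^ S n / (1 - q)).
    { apply Rmult_le_pos; [now apply pow_le|]. left. apply Rinv_0_lt_compat. lra. }
    nra. }
  intros P [eps HP].
  destruct (pow_lt_1_zero q ltac:(rewrite Rabs_right; lra) (eps * (1 - q))) as [N HN].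
  { apply Rmult_lt_0_compat; [apply cond_pos|lra]. }
  exists N. intros n Hn. apply HP.
  apply (C_NormedModule_mixin_compat1 (log_quotient w / 2)%C (S_ n w) eps).
  change (Cmod (S_ n w - log_quotient w / 2) < eps). rewrite Cmod_minus_sym.
  eapply Rle_lt_trans; [apply Rem|].
  specialize (HN (S n) ltac:(lia)). rewrite Rabs_right in HN by (apply Rle_ge, pow_le; lra).
  apply (Rmult_lt_reg_r (1 - q)); [lra|]. unfold Rdiv. rewrite Rmult_assoc, Rinv_l; lra.
Qed.

Lemma h5_inverse_log_coefficients : inverse_log_coefficients h5 h5_Gamma.
Proof.
  exists h5_inverse. split; [exact h5_local_inverse|].
  exists 1, log_quotient. split; [lra|]. split.
  - split; [exact log_quotient_0|]. intros w Hw. split; [now apply continuous_log_quotient|].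
    intros Hw0. rewrite Cexp_log_quotient by exact Hw. unfold h5_inverse.
    field. split; [now apply one_plus_iz_neq_0|exact Hw0].
  - intros w Hw. exists (log_quotient w / 2)%C. split; [now apply log_quotient_series|]. field.
Qed.

Lemma h5_determinant : Cmod (T21 h5_Gamma) = 5 / 16.
Proof.
  assert (E : T21 h5_Gamma = RtoC (- (5 / 16))).
  { unfold T21, h5_Gamma. simpl INR.
    assert (I : (Ci * Ci = - RtoC 1)%C) by (unfold Ci, Cmult, Copp, RtoC; simpl; f_equal; ring).
    replace (((- Ci) ^ 1 / (2 * 1)) ^ 2 - ((- Ci) ^ 2 / (2 * RtoC (1 + 1))) ^ 2)%C
      with ((Ci * Ci) / 4 - (Ci * Ci) * (Ci * Ci) / 16)%C by (rewrite RtoC_plus; field).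
    rewrite I, RtoC_opp, RtoC_div by lra. field. }
  rewrite E, Cmod_R, Rabs_left; lra.
Qed.

Theorem theorem2p3 :
  (forall (f : C -> C) (Gamma : nat -> C),
     starlike_symmetric f -> inverse_log_coefficients f Gamma ->
     Cmod (T21 Gamma) <= 5 / 16) /\
  (starlike_symmetric h5 /\
   exists Gamma : nat -> C,
     inverse_log_coefficients h5 Gamma /\ Cmod (T21 Gamma) = 5 / 16).
Proof.
  split; [exact toeplitz_determinant_bound|].
  split; [exact h5_starlike|].
  exists h5_Gamma. split; [exact h5_inverse_log_coefficients|exact h5_determinant].
Qed.
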